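(* Let $\widehat\Sigma\in\mathbb{R}^{n\times n}$ be symmetric strictly positive definite, and let $(H_t,D_t)_{t\ge0}$ be generated by $$H_{t+1}=\widehat\Sigma(H_tH_t^\top+D_t)^{-1}H_tR_t^{-1/2},\qquad D_{t+1}=\Delta(\widehat\Sigma-H_{t+1}H_{t+1}^\top),$$ $$R_t=I-H_t^\top(H_tH_t^\top+D_t)^{-1}H_t+H_t^\top(H_tH_t^\top+D_t)^{-1}\widehat\Sigma(H_tH_t^\top+D_t)^{-1}H_t,$$ started from $H_0\in\mathbb{R}^{n\times k}$ and a diagonal $D_0\ge0$ with $H_0H_0^\top+D_0$ invertible. Then: (a) $H_tH_t^\top\le\widehat\Sigma$ for all $t\ge1$. (b) If $D_0>0$ and $\Delta(\widehat\Sigma-D_0)>0$, then $D_t>0$ for all $t\ge1$. (c) The matrices $R_t$ are invertible for all $t\ge1$. (d) If $H_tH_t^\top+D_t=\widehat\Sigma$, then $H_{t+1}=H_t$ and $D_{t+1}=D_t$. (e) For every $t$, with $\widehat\Sigma_t=H_tH_t^\top+D_t$, $$\mathcal I(\widehat\Sigma\|\widehat\Sigma_t)-\mathcal I(\widehat\Sigma\|\widehat\Sigma_{t+1})=\mathcal I(\Sigma_{1,t+1}\|\Sigma_{1,t})+\mathcal I(\Sigma_{0,t}\|\Sigma_{0,t+1}).$$ (f) Every interior limit point $(H,D)$ of the algorithm (i.e. a limit point of the sequence $(H_t,D_t)$ with $D>0$) satisfies $$H=(\widehat\Sigma-HH^\top)D^{-1}H,\qquad D=\Delta(\widehat\Sigma-HH^\top).$$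 If $(H,D)$ is a solution to these equations, then $(HU,D)$ is also a solution for any unitary (orthogonal) matrix $U\in\mathbb{R}^{k\times k}$. (g) Every limit point $(\mathcal H,D)$ of the sequence $(\mathcal H_t,D_t)$, where $\mathcal H_t=H_tH_t^\top$, satisfies $$\mathcal H=\widehat\Sigma(\mathcal H+D)^{-1}\mathcal H,\qquad D=\Delta(\widehat\Sigma-\mathcal H).$$
   Context: $n,k$ are positive integers with $k<n$. For a square matrix $M$, $\Delta(M)$ is the diagonal matrix with the same diagonal as $M$. Inequalities between symmetric matrices are in the sense of (strict) positive definiteness. $R_t^{1/2}$ is the symmetric positive definite square root of $R_t$ and $R_t^{-1/2}$ its inverse. For two covariance (symmetric nonnegative definite) matrices $\Sigma_1,\Sigma_2$ of the same size $m\times m$, $\mathcal I(\Sigma_1\|\Sigma_2)$ denotes the I-divergence (Kullback-Leibler divergence) of $N(0,\Sigma_1)$ with respect to $N(0,\Sigma_2)$ ($+\infty$ if the first law is not absolutely continuous with respect to the second). If both are strictly positive definite, $\mathcal I(\Sigma_1\|\Sigma_2)=\frac12\log\frac{|\Sigma_2|}{|\Sigma_1|}-\frac m2+\frac12\mathrm{tr}(\Sigma_2^{-1}\Sigma_1)$. The matrices $\Sigma_{1,t},\Sigma_{0,t}$ are $(n+k)\times(n+k)$ covariance matrices defined as follows. Let $Q_0\in\mathbb{R}^{k\times k}$ be any invertible matrix and $Q_{t+1}=R_t^{1/2}Q_t$. Then $$\Sigma_{1,t}=\begin{pmatrix}H_tH_t^\top+D_t&H_tQ_t\\ (H_tQ_t)^\top&Q_t^\top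 Q_t\end{pmatrix},$$ and $\Sigma_{0,t}$ is the minimizer of $\Sigma_0\mapsto\mathcal I(\Sigma_0\|\Sigma_{1,t})$ over all $(n+k)\times(n+k)$ covariance matrices $\Sigma_0$ whose upper left $n\times n$ block equals $\widehat\Sigma$; explicitly $$\Sigma_{0,t}=\begin{pmatrix}\widehat\Sigma&\widehat\Sigma(H_tH_t^\top+D_t)^{-1}H_tQ_t\\ Q_t^\top H_t^\top(H_tH_t^\top+D_t)^{-1}\widehat\Sigma&Q_t^\top R_tQ_t\end{pmatrix}.$$ With these initial conditions the matrices $H_tH_t^\top+D_t$ are invertible for all $t$, so that the recursion is well defined. *)

(* Defs.v *)
From HB Require Import structures.
From mathcomp Require Import all_boot all_order all_algebra.
From mathcomp Require Import all_classical all_reals all_analysis.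
From mathcomp Require Import measurable_realfun.
Import Order.TTheory GRing.Theory Num.Theory.
Import numFieldNormedType.Exports.

Set Implicit Arguments.
Unset Strict Implicit.
Unset Printing Implicit Defensive.

Local Open Scope classical_set_scope.
Local Open Scope ring_scope.

Section matrices.
Context {R : realType} {m : nat}.
Implicit Types A B : 'M[R]_m.

Definition psdmx A : Prop :=
  A^T = A /\ forall x : 'cV[R]_m, 0 <= (x^T *m A *m x) 0 0.

Definition pdmx A : Prop :=
  A^T = A /\ forall x : 'cV[R]_m, x != 0 -> 0 < (x^T *m A *m x) 0 0.

Definition diagpart A : 'M[R]_m := diag_mx (\row_i A i i).

(* The nonnegative definite square root exists and is unique when [psdmx A],
   and it is positive definite when [pdmx A]; it is 0 if A has no such root. *)
Definition sqrtmx A : 'M[R]_m := xget 0 [set B | psdmx B /\ B *m B = A].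

End matrices.

Section kullback_leibler.
Context {d} {T : measurableType d} {R : realType}.
Local Open Scope ereal_scope.
Local Open Scope charge_scope.

(* The negative part of log (dP/dQ) is P-integrable, so that the integral never
   has the form oo - oo. *)
Definition kullback_leibler (P Q : probability T R) : \bar R :=
  if pselect (P `<< Q)
  then \int[P]_x lne (('d (charge_of_finite_measure P) '/d Q) x)
  else +oo.

End kullback_leibler.

(* R^m is represented by m-tuples, which carry the product sigma-algebra. *)
Section gaussian.
Context {R : realType}.

Definition cons_pair m (p : measurableTypeR R * m.-tuple (measurableTypeR R)) :
  m.+1.-tuple (measurableTypeR R) := [tuple of p.1 :: p.2].

Lemma measurable_cons_pair m : measurable_fun [set: _] (@cons_pair m).
Proof. exact: measurable_cons. Qed.

HB.instance Definition _ m :=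
  isMeasurableFun.Build _ _ _ _ (@cons_pair m) (@measurable_cons_pair m).

Fixpoint std_normal m : probability (m.-tuple (measurableTypeR R)) R :=
  match m with
  | 0 => \d_[tuple]
  | m'.+1 => distribution (normal_prob 0 1 \x std_normal m')%E (@cons_pair m')
  end.

Definition mulmx_tuple m (A : 'M[R]_m) (z : m.-tuple (measurableTypeR R)) :
  m.-tuple (measurableTypeR R) := [tuple \sum_j A i j * tnth z j | i < m].

Lemma measurable_mulmx_tuple m (A : 'M[R]_m) :
  measurable_fun [set: _] (mulmx_tuple A).
Proof.
apply/measurable_fun_tnthP => i.
rewrite [X in measurable_fun _ X](_ : _ =
  fun z => \sum_j A i j * tnth z j); last first.
  by apply/funext => z /=; rewrite tnth_mktuple.
apply: measurable_sum => j; apply: measurable_funM => //.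
exact: measurable_tnth.
Qed.

HB.instance Definition _ m (A : 'M[R]_m) :=
  isMeasurableFun.Build _ _ _ _ (mulmx_tuple A) (measurable_mulmx_tuple A).

(* N(0, Sigma), possibly degenerate: the law of Sigma^(1/2) Z, with Z standard
   normal. *)
Definition gaussian m (Sigma : 'M[R]_m) :
    probability (m.-tuple (measurableTypeR R)) R :=
  distribution (std_normal m) (mulmx_tuple (sqrtmx Sigma)).

Definition idiv m (Sigma1 Sigma2 : 'M[R]_m) : \bar R :=
  kullback_leibler (gaussian Sigma1) (gaussian Sigma2).

End gaussian.

Section factor_analysis.
Context {R : realType} {n k : nat}.
Variable Sigma : 'M[R]_n.
Implicit Types (H : 'M[R]_(n, k)) (D : 'M[R]_n) (Q : 'M[R]_k).

Definition fa_cov H D : 'M[R]_n := H *m H^T + D.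

Definition fa_R H D : 'M[R]_k :=
  1%:M - H^T *m invmx (fa_cov H D) *m H
  + H^T *m invmx (fa_cov H D) *m Sigma *m invmx (fa_cov H D) *m H.

Definition fa_algorithm (Hs : nat -> 'M[R]_(n, k)) (Ds : nat -> 'M[R]_n) :=
  forall t,
    Hs t.+1 = Sigma *m invmx (fa_cov (Hs t) (Ds t)) *m Hs t
              *m invmx (sqrtmx (fa_R (Hs t) (Ds t)))
    /\ Ds t.+1 = diagpart (Sigma - Hs t.+1 *m (Hs t.+1)^T).

Definition fa_Sigma1 H D Q : 'M[R]_(n + k) :=
  block_mx (fa_cov H D) (H *m Q)
           (H *m Q)^T   (Q^T *m Q).

Definition fa_Sigma0 H D Q : 'M[R]_(n + k) :=
  block_mx
    Sigma
    (Sigma *m invmx (fa_cov H D) *m H *m Q)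
    (Q^T *m H^T *m invmx (fa_cov H D) *m Sigma)
    (Q^T *m fa_R H D *m Q).

(* The first clause is the existence of the inverse in the second one. *)
Definition fa_solution H D : Prop :=
  [/\ D \in unitmx,
      H = (Sigma - H *m H^T) *m invmx D *m H
    & D = diagpart (Sigma - H *m H^T)].

End factor_analysis.

(* Main.v *)
(* Write S_t = H_t H_t^T + D_t.  The divergence of N(0, A) from N(0, B), for
   covariances A and B with the same kernel, is
     (ln det (B + P) - ln det (A + P) + tr ((B + P)^-1 (A - B))) / 2
   with P the orthogonal projector on that kernel; it follows from the linear
   change of variables for the standard normal law and from its second moments.
   A diagonal entry of D_t vanishes for all t or for none, hence all the matrices
   Sigma_1,t and Sigma_0,t have one kernel, and (e) becomes matrix algebra:
   Sigma_0,t = Sigma_1,t + Sigma_1,t U Sigma_1,t with U supported on the first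
   block, and Sigma_1,t+1 - Sigma_0,t is a matrix with zero diagonal supported on
   the first block, where a generalized inverse of Sigma_1,t is diagonal.
   The Schur complement of the last block of Sigma_0,t is Sigma - H_t+1 H_t+1^T;
   this gives (a) and (b).
   By (e) with Q_t = 1, I(Sigma || S_t) decreases and I(Sigma_1,t+1 || Sigma_1,t)
   tends to 0.  As tr M - m - ln det M >= |M^(1/2) - 1|^2, the difference of the
   two covariances tends to 0, and so does its block Sigma S_t^-1 H_t - H_t.
   Boundedness of I(Sigma || S_t) bounds S_t^-1, so limits of S_t are invertible
   and the fixed point equations pass to the limit. *)

Require Import Defs.
From mathcomp Require Import all_boot all_order all_algebra.
From mathcomp Require Import all_classical all_reals all_analysis.
From mathcomp Require Import measurable_realfun ring lra complex.
Import Order.TTheory GRing.Theory Num.Theory.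
Import numFieldNormedType.Exports.

Local Open Scope classical_set_scope.
Local Open Scope ring_scope.

Set Implicit Arguments.
Unset Strict Implicit.
Unset Printing Implicit Defensive.

(** * Gaussian integrals *)

Section normal_law_integrals.
Context {R : realType}.
Local Open Scope ereal_scope.
Local Notation leb := (@lebesgue_measure R).
Implicit Types f : R -> \bar R.

(** The obstacle is that [D_0] may be singular, in which case the joint laws have no Lebesgue
    density. One Gaussian law is therefore compared directly with another, both being images of the
    standard normal law under linear maps. Adding the projector [P] is harmless because [N(0, A)] is
    the image of [N(0, A + P)] under [1 - P]. The trace of [(B + P)^-1 (A - B)] is the same for
    every generalized inverse of [B] put in place of [(B + P)^-1]; this freedom allows one whose
    first block is diagonal, against which a zero-diagonal difference has trace zero. The identity
    (e) concerns a single step. For the limits it is restarted at every [t] with [Q_t = 1], which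
    keeps the traces of the matrices [Sigma_1,t] bounded. The factor [Q_t+1 = R_t^(1/2)] then
    cancels the root in the update of [H], so no square root of [R_t] is left in the gap whose limit
    is taken. The gap is finally multiplied by [S_t Sigma^-1], which leaves an expression polynomial
    in [H_t] and [D_t]. *)

Lemma integral_normal01 f : measurable_fun [set: R] f -> (forall x, 0 <= f x) ->
  \int[normal_prob 0 1]_x f x = \int[leb]_x (f x * (normal_pdf 0 1 x)%:E).
Proof.
move=> mf f0.
have dom := normal_prob_dominates (0%R : R) 1%R.
rewrite -(Radon_Nikodym_SigmaFinite.change_of_variables dom)//.
have mp : measurable_fun [set: R] (fun x : R => (normal_pdf 0 1 x)%:E).
  by apply/measurable_EFinP; exact: measurable_normal_pdf.
apply: ae_eq_integral => //.
- apply: emeasurable_funM => //.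
  exact: measurable_int (Radon_Nikodym_SigmaFinite.f_integrable dom).
- exact: emeasurable_funM.
- have : ae_eq leb setT (Radon_Nikodym_SigmaFinite.f (normal_prob (0%R : R) 1%R) leb)
      (fun x : R => (normal_pdf 0 1 x)%:E).
    apply: integral_ae_eq => //.
      exact: Radon_Nikodym_SigmaFinite.f_integrable.
    by move=> E _ mE; rewrite -Radon_Nikodym_SigmaFinite.f_integral.
  by apply: filterS => x xx _; rewrite xx.
Qed.

(** The image measure scaled by [|a|] agrees with Lebesgue measure on half-open intervals, which
    determine it. For [a < 0] the endpoints swap and the closed side changes, without effect on the
    length. *)
Lemma lebesgue_measure_affine (a b : R) : a != 0%R -> forall A, measurable A ->
  leb ((fun x => a * x + b)%R @^-1` A) = (`|a|^-1)%:E * leb A.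
Proof.
move=> a0.
have mphi : measurable_fun [set: measurableTypeR R] (fun x => a * x + b : measurableTypeR R)%R.
  by apply: measurable_funD => //; apply: measurable_funM.
have na : (0 < `|a|)%R by rewrite normr_gt0.
have [p pE] : exists p : {measure set (measurableTypeR R) -> \bar R},
    forall A, p A = leb ((fun x => a * x + b)%R @^-1` A).
  by unshelve eexists (pushforward leb (fun x : measurableTypeR R =>
      a * x + b : measurableTypeR R)%R).
pose nu := mscale (NngNum (ltW na)) p.
have E : forall A, measurable A -> leb A = nu A.
  apply: lebesgue_measure_unique => X [[c d]] /= _ <-.
  rewrite /nu /mscale /= pE.
  have [a_gt0|a_lt0] : (0 < a \/ a < 0)%R.
  - by case: (ltgtP a 0%R) a0 => //; auto.
  - have -> : (fun x => a * x + b)%R @^-1` `]c, d]%classic =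
              `]((c - b) / a)%R, ((d - b) / a)%R]%classic.
      apply/seteqP; split => x /=; rewrite !in_itv /= ltr_pdivrMr// ler_pdivlMr//;
        by rewrite [(x * a)%R]mulrC ltrBlDr lerBrDr.
    rewrite !lebesgue_measure_itv /= !lte_fin ltr_pM2r ?invr_gt0// ltrD2r.
    case: ifPn => _; last by rewrite mule0.
    rewrite -!EFinD -EFinM (gtr0_norm a_gt0); congr EFin; by field.
  - have -> : (fun x => a * x + b)%R @^-1` `]c, d]%classic =
              `[((d - b) / a)%R, ((c - b) / a)%R[%classic.
      apply/seteqP; split => x /=; rewrite !in_itv /= ltr_ndivlMr// ler_ndivrMr//;
        by rewrite [(x * a)%R]mulrC ltrBlDr lerBrDr andbC.
    rewrite !lebesgue_measure_itv /= !lte_fin ltr_nM2r ?invr_lt0// ltrD2r.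
    case: ifPn => _; last by rewrite mule0.
    rewrite -!EFinD -EFinM (ltr0_norm a_lt0); congr EFin; by field.
move=> A mA; rewrite (E _ mA) /nu /mscale /= pE muleA -EFinM mulVf ?gt_eqF//.
by rewrite mul1e.
Qed.

Lemma integral_lebesgue_affine (a b : R) f : a != 0%R ->
  measurable_fun [set: R] f -> (forall x, 0 <= f x) ->
  \int[leb]_x f (a * x + b)%R = (`|a|^-1)%:E * \int[leb]_x f x.
Proof.
move=> a0 mf f0.
have mphi : measurable_fun [set: measurableTypeR R] (fun x => a * x + b : measurableTypeR R)%R.
  by apply: measurable_funD => //; apply: measurable_funM.
have ia : (0 <= `|a|^-1)%R by [].
transitivity (\int[mscale (NngNum ia) leb]_x f x); last first.
  by rewrite ge0_integral_mscale.
transitivity (\int[pushforward leb (fun x : measurableTypeR R =>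
    a * x + b : measurableTypeR R)%R]_x f x).
  by rewrite ge0_integral_pushforward.
by apply: eq_measure_integral => A mA _; exact: lebesgue_measure_affine.
Qed.

(** The exponential weight is [phi(a x + b) / phi(x)]: it turns the normal density at [x] into the
    one at [a x + b], and the affine substitution for Lebesgue measure applies. *)
Lemma integral_normal_affine (a b : R) f : a != 0%R ->
  measurable_fun [set: R] f -> (forall x, 0 <= f x) ->
  \int[normal_prob 0 1]_x
    (f (a * x + b)%R * (expR ((x ^+ 2 - (a * x + b) ^+ 2) / 2))%:E) =
  (`|a|^-1)%:E * \int[normal_prob 0 1]_x f x.
Proof.
move=> a0 mf f0.
have maff : measurable_fun [set: measurableTypeR R] (fun x => a * x + b : measurableTypeR R)%R.
  by apply: measurable_funD => //; apply: measurable_funM.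
have me : measurable_fun [set: R] (fun x => expR ((x ^+ 2 - (a * x + b) ^+ 2) / 2))%R.
  apply: measurableT_comp => //; apply: measurable_funM => //.
  by apply: measurable_funB; apply: measurable_funX.
rewrite !integral_normal01//; last 2 first.
- apply: emeasurable_funM; last exact/measurable_EFinP.
  exact: (measurableT_comp mf maff).
- by move=> x; rewrite mule_ge0// lee_fin expR_ge0.
rewrite -(@integral_lebesgue_affine a b)//; last 2 first.
- apply: emeasurable_funM => //; by apply/measurable_EFinP; exact: measurable_normal_pdf.
- by move=> x; rewrite mule_ge0// lee_fin normal_pdf_ge0.
apply: eq_integral => x _; rewrite -muleA -EFinM; congr (_ * (_ : R)%:E).
rewrite !normal_pdfE ?oner_neq0// mulrCA -expRD; congr (_ * expR _)%R.
by rewrite !subr0 !expr1n; field.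
Qed.

End normal_law_integrals.

(** * Tuples as column vectors, and affine maps on them *)

Section vectors.
Context {R : realType}.
Local Notation T m := (m.-tuple (measurableTypeR R)).

Definition sqnorm m (v : 'cV[R]_m) : R := \sum_i v i 0 ^+ 2.

Definition vec_of m (z : T m) : 'cV[R]_m := \col_i tnth z i.

Definition tuple_of m (v : 'cV[R]_m) : T m := [tuple v i 0 | i < m].

Lemma vec_ofK m : cancel (@vec_of m) (@tuple_of m).
Proof. by move=> z; apply: eq_from_tnth => i; rewrite tnth_mktuple mxE. Qed.

Lemma tuple_ofK m : cancel (@tuple_of m) (@vec_of m).
Proof. by move=> v; apply/colP => i; rewrite mxE tnth_mktuple. Qed.

Lemma vec_of_cons m x (y : T m) :
  vec_of (cons_pair (x, y)) = col_mx x%:M (vec_of y) :> 'cV[R]_(1 + m).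
Proof.
apply/colP => i; rewrite !mxE (tnth_nth x) /=; case: splitP => j ->.
  by rewrite ord1 mxE mulr1n.
by rewrite mxE (tnth_nth x).
Qed.

Lemma tuple_of_cons m (x : R) (v : 'cV[R]_m) :
  tuple_of (col_mx x%:M v : 'cV[R]_(1 + m)) = cons_pair (x, tuple_of v).
Proof. by apply: (can_inj (@vec_ofK _)); rewrite vec_of_cons !tuple_ofK. Qed.

Lemma sqnorm_cons m (x : R) (v : 'cV[R]_m) :
  sqnorm (col_mx x%:M v : 'cV[R]_(1 + m)) = x ^+ 2 + sqnorm v.
Proof.
rewrite /sqnorm big_split_ord /= big_ord1 col_mxEu mxE mulr1n; congr +%R.
by apply: eq_bigr => i _; rewrite col_mxEd.
Qed.

Definition affine_map m (A : 'M[R]_m) (b : 'cV[R]_m) (z : T m) : T m :=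
  tuple_of (A *m vec_of z + b).

Lemma mulmx_tupleE m (A : 'M[R]_m) : mulmx_tuple A = affine_map A 0.
Proof.
apply/funext => z; apply: eq_from_tnth => i; rewrite !tnth_mktuple addr0 mxE.
by apply: eq_bigr => j _; rewrite mxE.
Qed.

Lemma measurable_vec_of_entry m i : measurable_fun [set: T m] (fun z => vec_of z i 0).
Proof.
rewrite (_ : (fun z => vec_of z i 0) = fun z => tnth z i); last first.
  by apply/funext => z; rewrite mxE.
exact: measurable_tnth.
Qed.

Lemma measurable_affine_entry m p (A : 'M[R]_(p, m)) (b : 'cV[R]_p) i :
  measurable_fun [set: T m] (fun z => (A *m vec_of z + b) i 0).
Proof.
under eq_fun do rewrite mxE mxE.
apply: measurable_funD => //; apply: measurable_sum => j.
by apply: measurable_funM => //; exact: measurable_vec_of_entry.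
Qed.

Lemma measurable_affine_map m (A : 'M[R]_m) b : measurable_fun setT (affine_map A b).
Proof.
apply/measurable_fun_tnthP => i.
rewrite [X in measurable_fun _ X](_ : _ = fun z => (A *m vec_of z + b) i 0).
  exact: measurable_affine_entry.
by apply/funext => z /=; rewrite tnth_mktuple.
Qed.

Lemma measurable_sqnorm_affine m p (A : 'M[R]_(p, m)) (b : 'cV[R]_p) :
  measurable_fun [set: T m] (fun z => sqnorm (A *m vec_of z + b)).
Proof.
apply: measurable_sum => i; apply: measurable_funX.
exact: measurable_affine_entry.
Qed.

Lemma measurable_sqnorm m : measurable_fun [set: T m] (fun z => sqnorm (vec_of z)).
Proof.
apply: measurable_sum => i; apply: measurable_funX.
exact: measurable_vec_of_entry.
Qed.

(* phi(A z + b) / phi(z), with phi the standard normal density. *)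
Definition gauss_ratio m (A : 'M[R]_m) b (z : T m) : R :=
  expR ((sqnorm (vec_of z) - sqnorm (A *m vec_of z + b)) / 2).

Lemma measurable_gauss_ratio m (A : 'M[R]_m) b :
  measurable_fun [set: T m] (gauss_ratio A b).
Proof.
apply: measurableT_comp => //; apply: measurable_funM => //.
apply: measurable_funB; first exact: measurable_sqnorm.
exact: measurable_sqnorm_affine.
Qed.

End vectors.

(** * Affine change of variables for the standard normal law *)

Section std_normal_affine.
Context {R : realType}.
Local Notation T m := (m.-tuple (measurableTypeR R)).
Local Open Scope ereal_scope.

Lemma integral_std_normalS1 m (h : T m.+1 -> \bar R) :
  measurable_fun setT h -> (forall z, 0 <= h z) ->
  \int[std_normal m.+1]_z h z =
  \int[normal_prob 0 1]_x \int[std_normal m]_y h (cons_pair (x, y)).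
Proof.
move=> mh h0; rewrite ge0_integral_distribution//.
rewrite fubini_tonelli1//; last by move=> ?; exact: h0.
exact: measurableT_comp.
Qed.

Lemma integral_std_normalS2 m (h : T m.+1 -> \bar R) :
  measurable_fun setT h -> (forall z, 0 <= h z) ->
  \int[std_normal m.+1]_z h z =
  \int[std_normal m]_y \int[normal_prob 0 1]_x h (cons_pair (x, y)).
Proof.
move=> mh h0; rewrite ge0_integral_distribution//.
rewrite fubini_tonelli2//; last by move=> ?; exact: h0.
exact: measurableT_comp.
Qed.

(* The change of variables x = A z + b, weighted so that A^-1 does not occur; in
   this form it is stable under composition. *)
Definition normal_affine m (A : 'M[R]_m) (b : 'cV[R]_m) :=
  forall h : T m -> \bar R, measurable_fun setT h -> (forall z, 0 <= h z) ->
  \int[std_normal m]_z (h (affine_map A b z) * (gauss_ratio A b z)%:E) =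
  (`|\det A|^-1)%:E * \int[std_normal m]_z h z.

Lemma affine_mapM m (A B : 'M[R]_m) b c z :
  affine_map A b (affine_map B c z) = affine_map (A *m B) (A *m c + b) z.
Proof. by rewrite /affine_map tuple_ofK mulmxDr mulmxA addrA. Qed.

(** The cocycle property of the weight; together with the multiplicativity of the determinant it
    makes [normal_affine] stable under composition. *)
Lemma gauss_ratioM m (A B : 'M[R]_m) b c z :
  (gauss_ratio A b (affine_map B c z) * gauss_ratio B c z =
   gauss_ratio (A *m B) (A *m c + b) z)%R.
Proof.
rewrite /gauss_ratio /affine_map tuple_ofK -expRD; congr expR.
by rewrite mulmxDr mulmxA addrA; field.
Qed.

Lemma normal_affineM m (A B : 'M[R]_m) b c :
  normal_affine A b -> normal_affine B c -> normal_affine (A *m B) (A *m c + b).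
Proof.
move=> nA nB h mh h0.
have mr := measurable_gauss_ratio A b.
have /(_ _ _)/esym := nB (fun z => h (affine_map A b z) * (gauss_ratio A b z)%:E).
rewrite nA// muleA -EFinM det_mulmx normrM invfM mulrC => ->.
- apply: eq_integral => z _; rewrite -gauss_ratioM EFinM muleA.
  by rewrite affine_mapM.
- apply: emeasurable_funM; last exact/measurable_EFinP.
  exact: (measurableT_comp mh (measurable_affine_map _ _)).
- by move=> z; rewrite mule_ge0// lee_fin expR_ge0.
Qed.

(** Fubini with the first coordinate innermost: for fixed [y] that coordinate undergoes the scalar
    map [x |-> a x + (w y + b)], while the others move by an affine map in which [x] does not
    occur. *)
Lemma normal_affine_ublock m (a : R) (w : 'rV[R]_m) (B : 'M[R]_m) (b : R) c :
  a != 0%R -> normal_affine B c ->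
  normal_affine (block_mx a%:M w 0 B : 'M[R]_(1 + m)) (col_mx b%:M c : 'cV[R]_(1 + m)).
Proof.
move=> a0 nB h mh h0.
set A := block_mx _ _ _ _; set d := col_mx _ _.
have mr := measurable_gauss_ratio A d.
have mcons := @measurable_cons_pair R m.
have imE x y : (A *m vec_of (cons_pair (x, y)) + d =
    col_mx (a * x + ((w *m vec_of y) 0 0 + b))%:M (B *m vec_of y + c))%R.
  rewrite vec_of_cons mul_block_col mul0mx add0r add_col_mx; congr col_mx.
  by apply/matrixP => i j; rewrite !ord1 !mxE !big_ord1 !mxE !mulr1n addrA.
rewrite [LHS]integral_std_normalS2; last 2 first.
- apply: emeasurable_funM; last exact/measurable_EFinP.
  exact: (measurableT_comp mh (measurable_affine_map _ _)).
- by move=> z; rewrite mule_ge0// lee_fin expR_ge0.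
have mhy y : measurable_fun setT (fun x : measurableTypeR R => h (cons_pair (x, y))).
  apply: (measurableT_comp mh); apply: (measurableT_comp mcons).
  exact: measurable_fun_pair.
have inner y : \int[normal_prob 0 1]_x
    (h (affine_map A d (cons_pair (x, y))) * (gauss_ratio A d (cons_pair (x, y)))%:E) =
  (`|a|^-1)%:E * \int[normal_prob 0 1]_x h (cons_pair (x, affine_map B c y))
  * (gauss_ratio B c y)%:E.
  rewrite -(@integral_normal_affine _ a ((w *m vec_of y) 0 0 + b)%R)//; last exact: mhy.
  rewrite -ge0_integralZr//; last 3 first.
  - apply: emeasurable_funM.
      apply: (measurableT_comp (mhy _)) => /=.
      by apply: measurable_funD => //; apply: measurable_funM.
    apply/measurable_EFinP; apply: measurableT_comp => //.
    apply: measurable_funM => //; apply: measurable_funB; apply: measurable_funX => //.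
    by apply: measurable_funD => //; apply: measurable_funM.
  - by move=> x _; rewrite mule_ge0// lee_fin expR_ge0.
  - by rewrite lee_fin expR_ge0.
  apply: eq_integral => x _; rewrite -muleA -EFinM; congr (h _ * (_ : R)%:E).
    by rewrite /affine_map imE tuple_of_cons.
  rewrite /gauss_ratio imE vec_of_cons !sqnorm_cons -expRD; congr expR; by field.
under eq_integral do rewrite inner -muleA.
rewrite ge0_integralZl//; last 2 first.
- apply: emeasurable_funM; last by apply/measurable_EFinP; exact: measurable_gauss_ratio.
  pose F (u : T m * measurableTypeR R) := h (cons_pair (u.2, affine_map B c u.1)).
  have mF : measurable_fun setT F.
    apply: (measurableT_comp mh); apply: (measurableT_comp mcons).
    apply: measurable_fun_pair => //=.
    by apply: (measurableT_comp (measurable_affine_map B c)).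
  apply: (@measurable_fun_fubini_tonelli_F _ _ _ _ _ (normal_prob 0 1) F) => //.
  by move=> x; exact: h0.
- by move=> y _; rewrite mule_ge0// ?lee_fin ?expR_ge0// integral_ge0.
rewrite [RHS](_ : _ = (`|a|^-1)%:E * ((`|\det B|^-1)%:E *
    \int[std_normal m]_y \int[normal_prob 0 1]_x h (cons_pair (x, y)))); last first.
  rewrite integral_std_normalS2// muleA -EFinM; congr (_%:E * _).
  rewrite (@det_ublock _ 1 m) normrM invfM; congr (`|_|^-1 * _)%R.
  by rewrite det_scalar expr1.
congr (_ * _); rewrite -nB//.
  pose F (u : T m * measurableTypeR R) := h (cons_pair (u.2, u.1)).
  apply: (@measurable_fun_fubini_tonelli_F _ _ _ _ _ (normal_prob 0 1) F) => //.
    apply: (measurableT_comp mh); apply: (measurableT_comp mcons).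
    by apply: measurable_fun_pair => //=.
  by move=> x; exact: h0.
by move=> y; rewrite integral_ge0.
Qed.

(** Fubini in the other order: for fixed [x] the remaining coordinates are translated by [x v]. This
    is where translations enter, even though only linear images are of interest in the end. *)
Lemma normal_affine_lshear m (v : 'cV[R]_m) :
  (forall c : 'cV[R]_m, normal_affine 1%:M c) ->
  normal_affine (block_mx 1%:M 0 v 1%:M : 'M[R]_(1 + m)) 0.
Proof.
move=> nB h mh h0; set A := block_mx _ _ _ _.
have mr := measurable_gauss_ratio A 0.
have mcons := @measurable_cons_pair R m.
have imE x y : (A *m vec_of (cons_pair (x, y)) + 0 =
    col_mx x%:M (1%:M *m vec_of y + x *: v))%R.
  rewrite addr0 vec_of_cons mul_block_col mul0mx addr0 mul1mx; congr col_mx.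
  by rewrite mul_mx_scalar addrC.
rewrite !integral_std_normalS1//; last 2 first.
- apply: emeasurable_funM; last exact/measurable_EFinP.
  exact: (measurableT_comp mh (measurable_affine_map _ _)).
- by move=> z; rewrite mule_ge0// lee_fin expR_ge0.
rewrite (@det_lblock _ 1 m) !det1 mulr1 normr1 invr1 mul1e.
apply: eq_integral => x _.
transitivity (\int[std_normal m]_y
  (h (cons_pair (x, affine_map 1%:M (x *: v) y)) * (gauss_ratio 1%:M (x *: v) y)%:E)).
  apply: eq_integral => y _; congr (h _ * (_ : R)%:E).
    by rewrite /affine_map imE tuple_of_cons.
  rewrite /gauss_ratio imE vec_of_cons !sqnorm_cons; congr expR; by field.
rewrite (nB _ (fun y => h (cons_pair (x, y))))//.
  by rewrite det1 normr1 invr1 mul1e.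
apply: (measurableT_comp mh); apply: (measurableT_comp mcons).
exact: measurable_fun_pair.
Qed.

End std_normal_affine.

(* Once its corner entry is nonzero, a matrix factors into a lower shear and a
   block upper triangular matrix; a shear on the right makes that entry nonzero. *)
Lemma std_normal_affine {R : realType} m (A : 'M[R]_m) b : A \in unitmx -> normal_affine A b.
Proof.
elim: m A b => [|m IH] A b uA.
  move=> h mh h0; rewrite det_mx00 normr1 invr1 mul1e; apply: eq_integral => z _.
  rewrite /gauss_ratio /sqnorm !big_ord0 subrr mul0r expR0 mule1.
  by rewrite [affine_map _ _ _]tuple0 [z]tuple0.
have shear v : normal_affine (block_mx 1%:M 0 v 1%:M : 'M[R]_(1 + m)) 0.
  by apply: normal_affine_lshear => c; apply: IH; exact: unitmx1.
have shear_unit (v : 'cV[R]_m) : (block_mx 1%:M 0 v 1%:M : 'M[R]_(1 + m)) \in unitmx.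
  by rewrite unitmxE (@det_lblock _ 1 m) !det1 mulr1 unitr1.
have shearV (v : 'cV[R]_m) : (block_mx 1%:M 0 v 1%:M : 'M[R]_(1 + m)) *m
    (block_mx 1%:M 0 (- v)%R 1%:M : 'M[R]_(1 + m)) = 1%:M.
  rewrite mulmx_block !mulmx0 !mul0mx !mulmx1 !mul1mx !addr0 !add0r addrN.
  by rewrite -(@scalar_mx_block _ 1 m).
have pivot (B : 'M[R]_(1 + m)) c : B \in unitmx -> (B 0 0 != 0)%R -> normal_affine B c.
  move=> uB B00; pose a := B 0 0.
  pose v := ((a^-1)%R *: dlsubmx B)%R.
  pose C := (drsubmx B - v *m ursubmx B)%R.
  have BE : B = (block_mx 1%:M 0 v 1%:M : 'M[R]_(1 + m)) *m
                (block_mx a%:M (ursubmx B) 0 C : 'M[R]_(1 + m)).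
    rewrite mulmx_block !mul0mx !mul1mx !addr0.
    rewrite addrC subrK mul_mx_scalar scalerA divff// scale1r -[LHS]submxK.
    congr (block_mx _ _ _ _); apply/matrixP => i j; rewrite !ord1 !mxE mulr1n.
    by congr (B _ _); exact/val_inj.
  have uC : C \in unitmx.
    move: uB; rewrite {1}BE unitmx_mul => /andP[_].
    by rewrite !unitmxE (@det_ublock _ 1 m) unitrM => /andP[].
  have cE : c = ((block_mx 1%:M 0 v 1%:M : 'M[R]_(1 + m)) *m
     col_mx (usubmx c) (dsubmx c - v *m usubmx c) + 0)%R.
    rewrite addr0 mul_block_col mul0mx !mul1mx addr0 addrC subrK.
    by rewrite vsubmxK.
  rewrite BE cE; apply: normal_affineM => //.
  rewrite [usubmx c]mx11_scalar; apply: normal_affine_ublock => //.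
  exact: IH.
have [w Aw] : exists w : 'cV[R]_m, ((A : 'M[R]_(1 + m)) *m
    (block_mx 1%:M 0 w 1%:M : 'M[R]_(1 + m))) 0 0 != 0.
  pose a := ulsubmx (A : 'M[R]_(1 + m)); pose r := ursubmx (A : 'M[R]_(1 + m)).
  have prod00 w : ((A : 'M[R]_(1 + m)) *m
      (block_mx 1%:M 0 w 1%:M : 'M[R]_(1 + m))) 0 0 = a 0 0 + (r *m w) 0 0.
    rewrite -[X in X *m _](@submxK _ 1 m 1 m) mulmx_block.
    rewrite (_ : 0 = lshift m (0 : 'I_1)); last exact/val_inj.
    by rewrite block_mxEul mulmx1 mxE.
  have [a0|a0] := eqVneq (a 0 0) 0; last first.
    by exists 0; rewrite prod00 mulmx0 [X in _ + X]mxE addr0.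
  (* The new corner is [a + r w]. If [a = 0], the choice [w = r^T] makes it [|r|^2], which vanishes
     only if the first row of [A] is zero. *)
  exists r^T; rewrite prod00 a0 add0r; apply/eqP => E.
  have r0 : r = 0.
    move: E; rewrite mxE => /eqP; rewrite psumr_eq0 => [/allP r0|i _]; last first.
      by rewrite [_^T _ _]mxE -expr2 sqr_ge0.
    apply/rowP => i; have := r0 i; rewrite mem_index_enum => /(_ isT) /=.
    by rewrite [_^T _ _]mxE mulf_eq0 orbb [RHS]mxE => /eqP.
  move: uA; rewrite unitmxE -[X in \det X](@submxK _ 1 m 1 m A) -/r r0.
  by rewrite (@det_lblock _ 1 m) -/a [a]mx11_scalar a0 det_scalar1 mul0r unitr0.
pose B : 'M[R]_(1 + m) := A *m (block_mx 1%:M 0 w 1%:M : 'M[R]_(1 + m)).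
have -> : A = B *m (block_mx 1%:M 0 (- w) 1%:M : 'M[R]_(1 + m)).
  by rewrite /B -mulmxA shearV mulmx1.
have -> : b = B *m (0 : 'cV[R]_(1 + m)) + b by rewrite mulmx0 add0r.
apply: normal_affineM; last exact: shear.
by apply: pivot => //; rewrite unitmx_mul uA shear_unit.
Qed.

(** * Positive semidefinite matrices *)

Section spectrum.
Context {R : realType}.

Lemma exists_interpolation (g : R -> R) (s : seq R) :
  exists p : {poly R}, forall x, x \in s -> p.[x] = g x.
Proof.
elim: s => [|y s [p ps]]; first by exists 0.
have [ys|ys] := boolP (y \in s).
  by exists p => x; rewrite inE => /predU1P[->|]; exact: ps.
pose q : {poly R} := \prod_(z <- s) ('X - z%:P).
have qy : q.[y] != 0 by rewrite -rootE root_prod_XsubC.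
exists (p + ((g y - p.[y]) / q.[y]) *: q) => x; rewrite inE => /predU1P[->|xs].
  by rewrite hornerD hornerZ divfK// addrC subrK.
have /eqP qx : root q x by rewrite root_prod_XsubC.
by rewrite hornerD hornerZ qx mulr0 addr0 ps.
Qed.

(** The complex spectral theorem, reduced to what can be stated over the reals. Real eigenvectors
    come from [det (A - r_i) = 0], and the last clause replaces diagonalization: polynomial
    identities in [A] may be checked on the eigenvalues. *)
Lemma symmetric_spectrum n (A : 'M[R]_n.+1) : A^T = A ->
  exists r : 'I_n.+1 -> R,
  [/\ forall i, exists2 v : 'cV_n.+1, v != 0 & A *m v = r i *: v,
      \det A = \prod_i r i, \tr A = \sum_i r i &
      forall p, (forall i, p.[r i] = 0) -> horner_mx A p = 0].
Proof.
move=> Asym; pose toC : {rmorphism R -> complex R} := real_complex R.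
have toCI : injective toC by exact: complexI.
pose Ac := map_mx toC A.
have Ah : Ac \is hermsymmx.
  apply: realsym_hermsym.
    by apply/is_hermitianmxP; rewrite expr0 scale1r map_mx_id// /Ac map_trmx Asym.
  by apply/mxOverP => i j; rewrite mxE; apply/complex_realP; exists (A i j).
have Anorm := hermitian_normalmx Ah.
pose P := spectralmx Ac; pose sp := spectral_diag Ac.
have PU : P \in unitmx := spectral_unit Ac.
have AE : Ac = invmx P *m diag_mx sp *m P by apply/orthomx_spectralP.
have /mxOverP spR := hermitian_spectral_diag_real Ah.
pose r i := complex.Re (sp 0 i).
have spE i : sp 0 i = toC (r i).
  by have /complex_realP[x xE] := spR 0 i; rewrite /r -/sp xE.
have detC (c : R) : \det (A - c%:M) = \prod_i (r i - c).
  apply: toCI; rewrite -det_map_mx map_mxB map_scalar_mx -/Ac AE.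
  have -> : invmx P *m diag_mx sp *m P - (toC c)%:M =
            invmx P *m (diag_mx sp - (toC c)%:M) *m P.
    rewrite mulmxBr mulmxBl; congr (_ - _).
    by rewrite -mulmxA mul_scalar_mx -scalemxAr mulVmx// scalemx1.
  rewrite !det_mulmx mulrAC -det_mulmx mulVmx// det1 mul1r.
  have -> : diag_mx sp - (toC c)%:M = diag_mx (\row_i (sp 0 i - toC c)).
    by apply/matrixP => i j; rewrite !mxE; case: eqP => // _; rewrite ?mulr1n ?mulr0n ?subrr.
  rewrite det_diag rmorph_prod; apply: eq_bigr => i _.
  by rewrite mxE spE rmorphB.
exists r; split.
- move=> i; have /eqP/det0P[v v0 vA] : \det (A - (r i)%:M) = 0.
    by rewrite detC (bigD1 i)//= subrr mul0r.
  exists v^T; first by rewrite -trmx0 (inj_eq trmx_inj).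
  apply: trmx_inj; rewrite trmx_mul trmxK Asym linearZ/= trmxK.
  by move/eqP: vA; rewrite mulmxBr subr_eq0 mul_mx_scalar => /eqP.
- by have := detC 0; rewrite raddf0 subr0 => ->; apply: eq_bigr => i _; rewrite subr0.
- apply: toCI; rewrite -trace_map_mx -/Ac AE mxtrace_mulC mulmxA.
  rewrite mulmxV// mul1mx mxtrace_diag rmorph_sum; apply: eq_bigr => i _.
  exact: spE.
- move=> p pr; apply: (map_mx_inj (f := toC)).
  rewrite map_horner_mx -/Ac AE horner_mx_uconjC// horner_mx_diag.
  rewrite [diag_mx _](_ : _ = 0) ?mulmx0 ?mul0mx ?map_mx0//.
  apply/matrixP => i j; rewrite !mxE spE horner_map pr rmorph0 mul0rn//.
Qed.

End spectrum.

Section positive_matrices.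
Context {R : realType}.

Lemma dotE m (x y : 'cV[R]_m) : (x^T *m y) 0 0 = \sum_i x i 0 * y i 0.
Proof. by rewrite mxE; apply: eq_bigr => i _; rewrite mxE. Qed.

Lemma dot_ge0 m (x : 'cV[R]_m) : 0 <= (x^T *m x) 0 0.
Proof. by rewrite dotE sumr_ge0// => i _; rewrite -expr2 sqr_ge0. Qed.

Lemma dot_eq0 m (x : 'cV[R]_m) : ((x^T *m x) 0 0 == 0) = (x == 0).
Proof.
apply/idP/eqP => [|->]; last by rewrite mulmx0 mxE.
rewrite dotE psumr_eq0 => [/allP x0|i _]; last by rewrite -expr2 sqr_ge0.
apply/colP => i; have := x0 i; rewrite mem_index_enum => /(_ isT) /=.
by rewrite mulf_eq0 orbb mxE => /eqP.
Qed.

Lemma dot_gt0 m (x : 'cV[R]_m) : x != 0 -> 0 < (x^T *m x) 0 0.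
Proof. by move=> x0; rewrite lt_def dot_eq0 x0 dot_ge0. Qed.

Lemma gram_psd m p (B : 'M[R]_(p, m)) : psdmx (B^T *m B).
Proof.
split=> [|x]; first by rewrite trmx_mul trmxK.
by rewrite mulmxA -trmx_mul -mulmxA; exact: dot_ge0.
Qed.

Lemma pd_psd m (A : 'M[R]_m) : pdmx A -> psdmx A.
Proof.
move=> [sA pA]; split=> // x; have [->|x0] := eqVneq x 0; last exact/ltW/pA.
by rewrite mulmx0 mxE.
Qed.

Lemma pd_unit m (A : 'M[R]_m) : pdmx A -> A \in unitmx.
Proof.
move=> [sA pA]; rewrite -row_free_unit -kermx_eq0; apply/rowV0P => v /sub_kermxP vA.
apply/eqP/negPn/negP => v0; have := pA v^T.
by rewrite -trmx0 (inj_eq trmx_inj) trmxK vA mul0mx mxE ltxx => /(_ v0).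
Qed.

Lemma invmxM m (A B : 'M[R]_m) : A \in unitmx -> B \in unitmx ->
  invmx (A *m B) = invmx B *m invmx A.
Proof.
move=> uA uB; have uAB : A *m B \in unitmx by rewrite unitmx_mul uA.
by rewrite -[RHS](mulKmx uAB) [A *m B *m _]mulmxA mulmxK// mulmxV// mulmx1.
Qed.

Lemma psd_add m (A B : 'M[R]_m) : psdmx A -> psdmx B -> psdmx (A + B).
Proof.
move=> [sA pA] [sB pB]; split=> [|x]; first by rewrite linearD/= sA sB.
by rewrite mulmxDr mulmxDl mxE addr_ge0.
Qed.

Lemma psd_congr m p (A : 'M[R]_m) (B : 'M[R]_(m, p)) : psdmx A -> psdmx (B^T *m A *m B).
Proof.
move=> [sA pA]; split=> [|x]; first by rewrite !trmx_mul trmxK sA mulmxA.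
by rewrite !mulmxA -trmx_mul -mulmxA; exact: pA.
Qed.

Lemma pd_congr m p (A : 'M[R]_m) (B : 'M[R]_(m, p)) :
  (forall x : 'cV_p, B *m x = 0 -> x = 0) -> pdmx A -> pdmx (B^T *m A *m B).
Proof.
move=> kB [sA pA]; split=> [|x x0]; first by rewrite !trmx_mul trmxK sA mulmxA.
rewrite !mulmxA -trmx_mul -mulmxA; apply: pA.
by apply: contra_neq x0; exact: kB.
Qed.

(* The root is a polynomial in A, so no eigenbasis has to be transported back
   from the complex field. *)
Lemma exists_psd_sqrt m (A : 'M[R]_m) : psdmx A -> exists B, psdmx B /\ B *m B = A.
Proof.
case: m A => [|m] A [sA pA].
  exists 0; split; last by apply/matrixP => -[].
  by split=> [|x]; [rewrite trmx0|rewrite mulmx0 mul0mx mxE].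
have [r [ev _ _ ann]] := symmetric_spectrum sA.
have r0 i : 0 <= r i.
  have [v v0 vA] := ev i; have := pA v.
  by rewrite -mulmxA vA -scalemxAr mxE pmulr_lge0// dot_gt0.
(* Fourth roots are interpolated rather than square roots: with [C = q(A)] symmetric, the root [C C]
   is a Gram matrix and so is nonnegative at once. *)
have [q qE] := exists_interpolation (fun x => Num.sqrt (Num.sqrt x)) (codom r).
have qi i : q.[r i] = Num.sqrt (Num.sqrt (r i)) by apply: qE; exact: codom_f.
pose C := horner_mx A q.
have CT : C^T = C.
  rewrite /C; elim/poly_ind: (q) => [|p c IH]; first by rewrite rmorph0 trmx0.
  rewrite !rmorphD !rmorphM /= horner_mx_X horner_mx_C linearD /= tr_scalar_mx.
  congr (_ + _); rewrite trmx_mul IH sA.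
  exact: (comm_mx_horner p (comm_mx_refl A)).
exists (C *m C); split; first by rewrite -{1}CT; exact: gram_psd.
have : horner_mx A (q ^+ 4 - 'X) = 0.
  apply: ann => i; rewrite !hornerE qi (exprM _ 2 2) !sqr_sqrtr ?sqrtr_ge0//.
  by rewrite subrr.
rewrite rmorphB /= rmorphXn /= horner_mx_X => /eqP; rewrite subr_eq0 => /eqP <-.
by rewrite (exprM _ 2 2) !expr2.
Qed.

Lemma sqrtmxP m (A : 'M[R]_m) : psdmx A -> psdmx (sqrtmx A) /\ sqrtmx A *m sqrtmx A = A.
Proof.
move=> /exists_psd_sqrt[B HB]; rewrite /sqrtmx.
by case: xgetP => [? -> []//|/(_ B)].
Qed.

(** Since [(B + 1)(B - 1) = 0], each column [y] of [B - 1] satisfies [y^T B y + y^T y = 0], and both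
    terms are nonnegative. *)
Lemma sqrtmx1 m : sqrtmx (1%:M : 'M[R]_m) = 1%:M.
Proof.
have [] := @sqrtmxP m 1%:M.
  by rewrite -[1%:M]mul1mx -{1}trmx1; exact: gram_psd.
set B := sqrtmx _ => -[sB pB] BB.
have H : (B + 1%:M) *m (B - 1%:M) = 0.
  by rewrite mulmxDl mulmxBr mulmxBr BB !mulmx1 !mul1mx addrC subrKA subrr.
apply/matrixP => i j; apply/eqP; rewrite -subr_eq0.
have := dot_ge0 (col j (B - 1%:M)); have := pB (col j (B - 1%:M)).
have : (B + 1%:M) *m col j (B - 1%:M) = 0 by rewrite colE mulmxA H mul0mx.
set y := col j _ => By0 y1 y2.
have : (y^T *m B *m y) 0 0 + (y^T *m y) 0 0 = 0.
  transitivity ((y^T *m ((B + 1%:M) *m y)) 0 0); last by rewrite By0 mulmx0 mxE.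
  by rewrite mulmxDl mul1mx mulmxDr [RHS]mxE mulmxA.
move=> E; have : (y^T *m y) 0 0 = 0 by apply/eqP; rewrite eq_le y2 andbT -E lerDr.
move/eqP; rewrite dot_eq0 => /eqP/colP/(_ i); rewrite !mxE => ->.
by rewrite eqxx.
Qed.

(** The quadratic form is the squared norm of [A^(1/2) x]. *)
Lemma psd_qform0 m (A : 'M[R]_m) (x : 'cV[R]_m) :
  psdmx A -> (x^T *m A *m x) 0 0 = 0 -> A *m x = 0.
Proof.
move=> pA E; have [[sB _] BB] := sqrtmxP pA; have Bx : sqrtmx A *m x = 0.
  apply/eqP; rewrite -dot_eq0 trmx_mul sB -mulmxA [sqrtmx A *m (_ *m x)]mulmxA BB.
  by rewrite mulmxA E.
by rewrite -[A in LHS]BB -mulmxA Bx mulmx0.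
Qed.

Lemma psd_unit_pd m (A : 'M[R]_m) : psdmx A -> A \in unitmx -> pdmx A.
Proof.
move=> pA uA; split=> [|x x0]; first by case: pA.
rewrite lt_def; apply/andP; split; last exact: pA.2.
apply: contra_neq x0 => /(psd_qform0 pA) Ax.
by rewrite -[x](mulKmx uA) Ax mulmx0.
Qed.

Lemma pd_det_gt0 m (A : 'M[R]_m) : pdmx A -> 0 < \det A.
Proof.
move=> pA; have [[_ _] BB] := sqrtmxP (pd_psd pA).
have := pd_unit pA; rewrite unitmxE unitfE lt_def => -> /=.
by rewrite -[X in \det X]BB det_mulmx -expr2 sqr_ge0.
Qed.

Lemma pd_inv m (A : 'M[R]_m) : pdmx A -> pdmx (invmx A).
Proof.
move=> pA; have uA := pd_unit pA; have [sA _] := pA.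
have -> : invmx A = (invmx A)^T *m A *m invmx A.
  by rewrite trmx_inv sA mulVmx// mul1mx.
apply: pd_congr => // x Ax0.
by rewrite -[x](mulKVmx uA) Ax0 mulmx0.
Qed.

End positive_matrices.

(** * The divergence of two Gaussian laws *)

Section second_moments.
Context {R : realType} {m : nat}.
Local Notation T := (m.-tuple (measurableTypeR R)).
Local Notation mu := (@std_normal R m).

Let scale_entry (j : 'I_m) (u : R) : 'M[R]_m :=
  diag_mx (\row_i (if i == j then u else 1)).

Let det_scale_entry j u : \det (scale_entry j u) = u.
Proof.
rewrite det_diag (bigD1 j)//= mxE eqxx big1 ?mulr1// => i ij.
by rewrite mxE (negbTE ij).
Qed.

Let scale_entryE j u (v : 'cV[R]_m) i :
  (scale_entry j u *m v) i 0 = (if i == j then u else 1) * v i 0.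
Proof. by rewrite mul_diag_mx !mxE. Qed.

Let sqnorm_scale_entry j u (v : 'cV[R]_m) :
  sqnorm v - sqnorm (scale_entry j u *m v) = (1 - u ^+ 2) * v j 0 ^+ 2.
Proof.
rewrite /sqnorm (bigD1 j)//= [X in _ - X](bigD1 j)//= scale_entryE eqxx.
rewrite [X in _ - (_ + X)](eq_bigr (fun i => v i 0 ^+ 2)); last first.
  by move=> i ij; rewrite scale_entryE (negbTE ij) mul1r.
by ring.
Qed.

Let integral_one : (\int[mu]_z cst 1 z = 1)%E.
Proof. by rewrite integral_cst// mul1e; exact: probability_setT. Qed.

Let integral_exp_sqr j (u : R) : 0 < u ->
  (\int[mu]_z (expR ((1 - u ^+ 2) / 2 * vec_of z j 0 ^+ 2))%:E = u^-1%:E)%E.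
Proof.
move=> u0; have uA : scale_entry j u \in unitmx.
  by rewrite unitmxE det_scale_entry unitfE gt_eqF.
have := std_normal_affine 0 uA (h := cst 1%E) (measurable_cst _) (fun=> lee01).
rewrite det_scale_entry gtr0_norm// integral_one mule1 => <-.
apply: eq_integral => z _; rewrite mul1e /gauss_ratio addr0 sqnorm_scale_entry.
by congr (expR _)%:E; field.
Qed.

Let measurable_sqr_entry j :
  measurable_fun [set: T] (fun z => vec_of z j 0 ^+ 2).
Proof. by apply: measurable_funX; exact: measurable_vec_of_entry. Qed.

Let measurable_exp_sqr j (c : R) :
  measurable_fun [set: T] (fun z => (expR (c * vec_of z j 0 ^+ 2))%:E).
Proof.
apply/measurable_EFinP; apply: measurableT_comp => //; apply: measurable_funM => //.
Qed.

(* Integrating [1 + s <= exp s] at [s = (1 - u^2) z_j^2 / 2], where the right-hand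
   side has integral 1/u, bounds the second moment from above for u < 1 and from
   below for u > 1; let u tend to 1. *)
Lemma std_normal_sqr j : (\int[mu]_z (vec_of z j 0 ^+ 2)%:E = 1)%E.
Proof.
set V := (\int[mu]_z _)%E.
have V0 : (0 <= V)%E by apply: integral_ge0 => z _; rewrite lee_fin sqr_ge0.
have intZ (c : R) : 0 <= c ->
    (\int[mu]_z (c * vec_of z j 0 ^+ 2)%:E = c%:E * V)%E.
  move=> c0; under eq_integral do rewrite EFinM.
  apply: ge0_integralZl => //; first by apply/measurable_EFinP; exact: measurable_sqr_entry.
  by move=> z _; rewrite lee_fin sqr_ge0.
have below (u : R) : 0 < u -> u <= 1 ->
    (1 + ((1 - u ^+ 2) / 2)%:E * V <= u^-1%:E)%E.
  move=> u0 u1; have c0 : 0 <= (1 - u ^+ 2) / 2.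
    by rewrite divr_ge0// subr_ge0 expr_le1// ltW.
  rewrite -(integral_exp_sqr j u0) -intZ//.
  rewrite -[X in (X + _ <= _)%E]integral_one.
  rewrite -ge0_integralD//; last 2 first.
  - by move=> z _; rewrite lee_fin mulr_ge0// sqr_ge0.
  - by apply/measurable_EFinP; apply: measurable_funM => //; exact: measurable_sqr_entry.
  apply: ge0_le_integral => //.
  - by move=> z _; rewrite adde_ge0// lee_fin mulr_ge0// sqr_ge0.
  - apply: emeasurable_funD => //; apply/measurable_EFinP.
    by apply: measurable_funM => //; exact: measurable_sqr_entry.
  - by move=> z _; rewrite -EFinD lee_fin expR_ge1Dx.
have above (u : R) : 1 <= u ->
    (1 <= u^-1%:E + ((u ^+ 2 - 1) / 2)%:E * V)%E.
  move=> u1; have u0 : 0 < u by exact: lt_le_trans u1.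
  have c0 : 0 <= (u ^+ 2 - 1) / 2 by rewrite divr_ge0//; nra.
  rewrite -(integral_exp_sqr j u0) -intZ//.
  rewrite -[X in (X <= _)%E]integral_one.
  rewrite -ge0_integralD//; last 2 first.
  - by move=> z _; rewrite lee_fin mulr_ge0// sqr_ge0.
  - by apply/measurable_EFinP; apply: measurable_funM => //; exact: measurable_sqr_entry.
  apply: ge0_le_integral => //.
  - apply: emeasurable_funD => //; apply/measurable_EFinP.
    by apply: measurable_funM => //; exact: measurable_sqr_entry.
  - move=> z _; rewrite -EFinD lee_fin -lerBlDr.
    apply: le_trans (expR_ge1Dx _).
    by rewrite le_eqVlt; apply/orP; left; apply/eqP; field.
(* At [u = 1/2] an infinite second moment would give [+oo <= 2]. *)
have Vfin : V \is a fin_num.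
  rewrite ge0_fin_numE// ltNge leye_eq; apply/negP => /eqP VE.
  have := @below (2^-1); rewrite VE gt0_muley; last first.
    by rewrite lte_fin; lra.
  rewrite addey// leye_eq => /(_ _ _)/eqP H.
  by suff : (2^-1^-1)%:E = +oo%E :> \bar R by []; apply: H; lra.
move: V0 below above; rewrite -(fineK Vfin); move: (fine V) => r.
rewrite lee_fin => r0 below above; congr EFin; apply/eqP; rewrite eq_le; apply/andP; split.
- apply/ler_addgt0Pr => e e0.
  (* Chosen so that [1/u = 1 + e/2]; the bound becomes [r (1 + e/4) <= (1 + e/2)^2], whose
     right-hand side is at most [(1 + e)(1 + e/4)]. *)
  pose u := (1 + e / 2)^-1.
  have u1 : 0 < 1 + e / 2 by lra.
  have := below u; rewrite invr_gt0 => /(_ u1).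
  rewrite invf_le1// lerDl => /(_ _)/wrap[]; first by lra.
  rewrite -EFinM -EFinD lee_fin invrK.
  have -> : 1 + (1 - u ^+ 2) / 2 * r =
    1 + (e + e ^+ 2 / 4) * r / (2 * (1 + e / 2) ^+ 2).
    by rewrite /u; field; rewrite gt_eqF//; lra.
  rewrite lerD2l ler_pdivrMr; last by rewrite mulr_gt0// exprn_gt0.
  by nra.
(* At [u = 1 + h] the bound reads [2 <= (1 + h)(2 + h) r], whereas [(1 + h)(2 + h)(1 - 2h) = 2 - h -
   5h^2 - 2h^3] is less than 2. *)
- apply/ler_addgt0Pr => e e0; pose h := e / 2.
  have h0 : 0 < h by rewrite /h; lra.
  have := above (1 + h) _; rewrite -EFinM -EFinD lee_fin => /(_ _)/wrap[]; first by lra.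
  have u1 : 0 < 1 + h by lra.
  rewrite -(ler_pM2l u1) mulrDr mulfV ?gt_eqF// mulr1 => H.
  have {}H : 2 <= (1 + h) * (2 + h) * r by rewrite -(ler_pM2l h0); lra.
  have -> : e = 2 * h by rewrite /h; field.
  rewrite leNgt; apply/negP => rh.
  have : (1 + h) * (2 + h) * r <= (1 + h) * (2 + h) * (1 - 2 * h).
    by rewrite ler_pM2l; [lra|nra].
  by have := mulr_gt0 h0 h0; have := mulr_gt0 (mulr_gt0 h0 h0) h0; lra.
Qed.

Let integrable_sqr j : mu.-integrable setT (fun z => (vec_of z j 0 ^+ 2)%:E).
Proof.
apply/integrableP; split; first by apply/measurable_EFinP; exact: measurable_sqr_entry.
under eq_integral do rewrite /= ger0_norm ?sqr_ge0//.
by rewrite std_normal_sqr ltry.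
Qed.

Lemma integrable_std_normal_mul i j :
  mu.-integrable setT (fun z => (vec_of z i 0 * vec_of z j 0)%:E).
Proof.
apply: (@le_integrable _ _ _ _ _ measurableT _
    (fun z => (vec_of z i 0 ^+ 2)%:E + (vec_of z j 0 ^+ 2)%:E)%E).
- apply/measurable_EFinP; apply: measurable_funM; exact: measurable_vec_of_entry.
- move=> z _; rewrite -EFinD /= lee_fin ler_norml (ger0_norm (addr_ge0 _ _)) ?sqr_ge0//.
  by apply/andP; split; nra.
- exact: integrableD.
Qed.

(** Changing the sign of [z_j] preserves the law, so [(z_i + z_j)^2] and [(z_i - z_j)^2] have the
    same mean. Squares are used because the change of variables is stated for nonnegative
    integrands. *)
Lemma std_normal_mul i j :
  (\int[mu]_z (vec_of z i 0 * vec_of z j 0)%:E = ((i == j)%:R)%:E)%E.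
Proof.
have [->|ij] := eqVneq i j; first by rewrite -[RHS](std_normal_sqr j).
have sgnA : scale_entry j (-1) \in unitmx.
  by rewrite unitmxE det_scale_entry unitfE oppr_eq0 oner_eq0.
pose h (z : T) := ((vec_of z i 0 + vec_of z j 0) ^+ 2)%:E.
have mh : measurable_fun setT h.
  apply/measurable_EFinP; apply: measurable_funX; apply: measurable_funD;
  exact: measurable_vec_of_entry.
have := std_normal_affine 0 sgnA mh (fun=> sqr_ge0 _).
rewrite det_scale_entry normrN1 invr1 mul1e => H.
have : (\int[mu]_z (((vec_of z i 0 ^+ 2)%:E + (vec_of z j 0 ^+ 2)%:E)
    - 2%:E * (vec_of z i 0 * vec_of z j 0)%:E) =
  \int[mu]_z (((vec_of z i 0 ^+ 2)%:E + (vec_of z j 0 ^+ 2)%:E)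
    + 2%:E * (vec_of z i 0 * vec_of z j 0)%:E))%E.
  transitivity (\int[mu]_z h z)%E; last first.
    by apply: eq_integral => z _; rewrite /h -EFinM -!EFinD; congr EFin; ring.
  rewrite -H; apply: eq_integral => z _.
  rewrite /gauss_ratio addr0 sqnorm_scale_entry sqrrN expr1n subrr mul0r mul0r expR0 mule1.
  rewrite /h /affine_map tuple_ofK addr0 !scale_entryE eqxx (negbTE ij).
  by rewrite -EFinM -[LHS]/((_ + _ - _)%:E); congr EFin; ring.
have iM := integrable_std_normal_mul i j.
have i2 := integrableZl measurableT 2 iM.
have iS := integrableD measurableT (integrable_sqr i) (integrable_sqr j).
rewrite integralB// [in RHS]integralD// integralZl// integralD// !std_normal_sqr.
have : (\int[mu]_z (vec_of z i 0 * vec_of z j 0)%:E)%E \is a fin_num.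
  exact: integrable_fin_num.
move=> /fineK <-; rewrite -EFinM -!EFinD => -[] E.
congr EFin; move: E; set x := fine _ => E; have -> : false%:R = 0 :> R by [].
by clearbody x; lra.
Qed.

Lemma std_normal_qformE (W : 'M[R]_m) (c : R) (z : T) :
  (c + ((vec_of z)^T *m W *m vec_of z) 0 0)%:E =
  (c%:E + \sum_j \sum_i (W i j)%:E * (vec_of z i 0 * vec_of z j 0)%:E)%E.
Proof.
rewrite EFinD; congr (_ + _)%E; rewrite mxE -sumEFin; apply: eq_bigr => j _.
rewrite mxE mulr_suml -sumEFin; apply: eq_bigr => i _.
by rewrite -EFinM [_^T _ _]mxE; congr EFin; ring.
Qed.

Let integrable_term (W : 'M[R]_m) i j :
  mu.-integrable setT (fun z => (W i j)%:E * (vec_of z i 0 * vec_of z j 0)%:E)%E.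
Proof. exact: (integrableZl measurableT (W i j) (integrable_std_normal_mul i j)). Qed.

Let integrable_col (W : 'M[R]_m) j : mu.-integrable setT
  (fun z => \sum_i ((W i j)%:E * (vec_of z i 0 * vec_of z j 0)%:E))%E.
Proof. by apply: integrable_sum => // i _; exact: integrable_term. Qed.

Lemma integrable_std_normal_qform (W : 'M[R]_m) (c : R) :
  mu.-integrable setT (fun z => (c + ((vec_of z)^T *m W *m vec_of z) 0 0)%:E).
Proof.
rewrite (_ : (fun _ => _) = fun z => (c%:E +
    \sum_j \sum_i (W i j)%:E * (vec_of z i 0 * vec_of z j 0)%:E)%E); last first.
  by apply/funext => z; rewrite std_normal_qformE.
apply: integrableD => //; first exact: finite_measure_integrable_cst.
by apply: integrable_sum => // j _; exact: integrable_col.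
Qed.

Lemma integral_std_normal_qform (W : 'M[R]_m) (c : R) :
  (\int[mu]_z (c + ((vec_of z)^T *m W *m vec_of z) 0 0)%:E = (c + \tr W)%:E)%E.
Proof.
under eq_integral do rewrite std_normal_qformE.
rewrite integralD//; last 2 first.
- exact: finite_measure_integrable_cst.
- by apply: integrable_sum => // j _; exact: integrable_col.
rewrite (integral_cst mu measurableT) EFinD; congr (_ + _)%E.
  by rewrite -[RHS]mule1; congr (_ * _)%E; exact: probability_setT.
rewrite integral_sum// /mxtrace -sumEFin; apply: eq_bigr => j _.
rewrite integral_sum//.
rewrite (bigD1 j)//= big1 => [|i ij].
  rewrite integralZl//; last exact: integrable_std_normal_mul.
  by rewrite std_normal_mul eqxx mule1 adde0.
rewrite integralZl//; last exact: integrable_std_normal_mul.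
by rewrite std_normal_mul (negbTE ij) mule0.
Qed.

End second_moments.

(** * The divergence computed from a density *)

Section density.
Context d (T : measurableType d) (R : realType).
Local Open Scope ereal_scope.
Local Open Scope charge_scope.

(** The Radon-Nikodym derivative equals [f] outside a [Q]-null set, which is also [P]-null by
    absolute continuity; the two logarithms thus have the same integral under [P]. *)
Lemma kullback_leibler_density (P Q : probability T R) (f : T -> R) :
  measurable_fun setT f -> (forall x, 0 < f x)%R ->
  (forall A, measurable A -> P A = \int[Q]_(x in A) (f x)%:E) ->
  kullback_leibler P Q = \int[P]_x (ln (f x))%:E.
Proof.
move=> mf f0 PE.
have mEf : measurable_fun setT (EFin \o f) by exact/measurable_EFinP.
have PQ : P `<< Q.
  apply/null_content_dominatesP => A mA QA0; rewrite PE//.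
  by apply: null_set_integral => //; exact: measurable_funTS.
rewrite /kullback_leibler; case: pselect => // PQ'.
have RN : ae_eq Q setT ('d (charge_of_finite_measure P) '/d Q) (EFin \o f).
  apply: integral_ae_eq => //; first exact: Radon_Nikodym_integrable.
  by move=> A _ mA; rewrite -Radon_Nikodym_integral//= -PE.
apply: ae_eq_integral => //.
- have mRN : measurable_fun setT ('d (charge_of_finite_measure P) '/d Q).
    by apply: measurable_int; exact: Radon_Nikodym_integrable.
  rewrite (_ : (fun _ => _) = fun x =>
      if ('d (charge_of_finite_measure P) '/d Q) x <= 0 then -oo
      else (ln (fine (('d (charge_of_finite_measure P) '/d Q) x)))%:E).
    apply: measurable_fun_ifT => //; first exact: measurable_fun_lee.
    apply/measurable_EFinP; apply: measurableT_comp; first exact: measurable_ln.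
    exact: measurableT_comp.
  apply/funext => x; have := @Radon_Nikodym_fin_num _ _ _
    (charge_of_finite_measure P) Q x PQ.
  by case: (_ x) => //= r _; rewrite lee_fin.
- by apply/measurable_EFinP; apply: measurableT_comp => //; exact: measurable_ln.
- case: RN => N [mN QN0 sN]; exists N; split => //.
    by have /null_content_dominatesP := PQ; apply.
  apply: subset_trans sN; apply: subsetC => x /= xE _.
  by have -> : ('d (charge_of_finite_measure P) '/d Q) x = (f x)%:E := xE I; exact: lne_EFin.
Qed.

End density.

Section gaussian_divergence.
Context {R : realType} {m : nat}.
Local Notation T := (m.-tuple (measurableTypeR R)).

(* For covariances A and B with a common kernel, adding the orthogonal projector P
   on that kernel makes both invertible without changing the divergence. *)
Definition gauss_div (P A B : 'M[R]_m) : R :=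
  (ln (\det (B + P)) - ln (\det (A + P)) + \tr (invmx (B + P) *m (A - B))) / 2.

(* P is the orthogonal projector on the kernel of A: the last clause forces the
   range of P to be the whole kernel. *)
Definition kernel_proj (P A : 'M[R]_m) : Prop :=
  [/\ P^T = P, P *m P = P, A *m P = 0 & pdmx (A + P)].

End gaussian_divergence.

Section gaussian_idiv.
Context {R : realType} {m : nat}.
Local Notation T := (m.-tuple (measurableTypeR R)).
Variables P A B : 'M[R]_m.
Hypothesis psdA : psdmx A.
Hypothesis psdB : psdmx B.
Hypothesis PA : kernel_proj P A.
Hypothesis PB : kernel_proj P B.

(** [C^(1/2)] and [P] annihilate each other, so [C^(1/2) + P] is an invertible root of [C + P], and
    [1 - P] maps it back to [C^(1/2)]. *)
Lemma kernel_proj_sqrt (C : 'M[R]_m) : psdmx C -> kernel_proj P C ->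
  [/\ sqrtmx C *m P = 0, P *m sqrtmx C = 0,
      (sqrtmx C + P) *m (sqrtmx C + P) = C + P & sqrtmx C + P \in unitmx].
Proof.
move=> psdC [PT PP CP pdC]; have [[sS _] SS] := sqrtmxP psdC.
have SP : sqrtmx C *m P = 0.
  apply/matrixP => i j; apply/eqP.
  have : sqrtmx C *m P *m delta_mx j (0 : 'I_1) = 0.
    apply/eqP; rewrite -dot_eq0 !trmx_mul sS.
    rewrite -!mulmxA [X in _ *m (_ *m X)]mulmxA SS [X in _ *m (_ *m X)]mulmxA CP.
    by rewrite mul0mx !mulmx0 mxE.
  by rewrite -colE => /colP/(_ i); rewrite !mxE => ->.
have PS : P *m sqrtmx C = 0.
  by apply: trmx_inj; rewrite trmx_mul sS PT SP trmx0.
have E : (sqrtmx C + P) *m (sqrtmx C + P) = C + P.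
  by rewrite mulmxDl !mulmxDr SS SP PS PP addr0 add0r.
split=> //; have := pd_unit pdC.
by rewrite -E unitmx_mul => /andP[].
Qed.

Lemma kernel_proj_inv (C : 'M[R]_m) : psdmx C -> kernel_proj P C ->
  invmx (C + P) *m P = P /\ P *m invmx (C + P) = P.
Proof.
move=> psdC [PT PP CP pdC]; have uC := pd_unit pdC.
have E : (C + P) *m P = P by rewrite mulmxDl CP PP add0r.
have EP : invmx (C + P) *m P = P by rewrite -{2}E mulKmx.
split=> //; apply: trmx_inj; rewrite trmx_mul trmx_inv linearD/= PT.
by case: psdC => -> _.
Qed.

Let S1 := sqrtmx A.
Let S2 := sqrtmx B.
Let Delta := invmx (B + P) - invmx (A + P).
Let k := `|\det (S2 + P)| / `|\det (S1 + P)|.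

(** The density of [N(0, A)] with respect to [N(0, B)]: [k] is the square root of
    [det (B + P) / det (A + P)], and [P] drops out of the exponent because [Delta P = 0]. *)
Let density (x : T) : R := k * expR (((vec_of x)^T *m Delta *m vec_of x) 0 0 / 2).

Let DeltaP : Delta *m P = 0.
Proof.
by rewrite mulmxBl (kernel_proj_inv psdA PA).1 (kernel_proj_inv psdB PB).1 subrr.
Qed.

Let PDelta : P *m Delta = 0.
Proof.
by rewrite mulmxBr (kernel_proj_inv psdA PA).2 (kernel_proj_inv psdB PB).2 subrr.
Qed.

Let k_gt0 : 0 < k.
Proof.
have [_ _ _ u1] := kernel_proj_sqrt psdA PA.
have [_ _ _ u2] := kernel_proj_sqrt psdB PB.
by rewrite divr_gt0// normr_gt0 -unitfE -unitmxE.
Qed.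

Let density_gt0 x : 0 < density x.
Proof. by rewrite mulr_gt0// expR_gt0. Qed.

Lemma measurable_qform (W : 'M[R]_m) :
  measurable_fun [set: T] (fun x => ((vec_of x)^T *m W *m vec_of x) 0 0).
Proof.
under eq_fun => x.
  rewrite mxE; under eq_bigr => j _.
    rewrite mxE mulr_suml; under eq_bigr => i _ do rewrite mxE. over.
  over.
apply: measurable_sum => j; apply: measurable_sum => i.
apply: measurable_funM; last exact: measurable_vec_of_entry.
by apply: measurable_funM => //; exact: measurable_vec_of_entry.
Qed.

Let measurable_density : measurable_fun setT density.
Proof.
apply: measurable_funM => //; apply: measurableT_comp => //.
by apply: measurable_funM => //; exact: measurable_qform.
Qed.

Let gaussianE (C : 'M[R]_m) (h : T -> \bar R) : measurable_fun setT h ->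
  (forall x, 0 <= h x)%E ->
  (\int[gaussian C]_x h x = \int[std_normal m]_z h (affine_map (sqrtmx C) 0 z))%E.
Proof.
move=> mh h0; rewrite ge0_integral_distribution//.
by apply: eq_integral => z _; rewrite /= mulmx_tupleE.
Qed.

(** With [G = (S1 + P)^-1 (S2 + P)], the substitution [z = G z'] turns [(S1 + P) z] into
    [(S2 + P) z']; applying [1 - P] to both gives [S1 z] and [S2 z'], samples of the two laws. *)
Let gaussian_density (X : set T) : measurable X ->
  gaussian A X = (\int[gaussian B]_(x in X) (density x)%:E)%E.
Proof.
move=> mX.
have [S1P PS1 SS1 u1] := kernel_proj_sqrt psdA PA.
have [S2P PS2 SS2 u2] := kernel_proj_sqrt psdB PB.
have [PT PP _ _] := PA.
pose E := 1%:M - P.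
have ES1 : E *m (S1 + P) = S1.
  by rewrite mulmxBl mul1mx mulmxDr PS1 PP add0r addrK.
have ES2 : E *m (S2 + P) = S2.
  by rewrite mulmxBl mul1mx mulmxDr PS2 PP add0r addrK.
have mI : measurable_fun setT (fun x : T => (\1_X x : R)%:E).
  by apply/measurable_EFinP; exact: measurable_indic.
pose g z := (\1_X (affine_map E 0 z) : R)%:E.
have mg : measurable_fun setT g.
  exact: (measurableT_comp mI (measurable_affine_map _ _)).
pose G := invmx (S1 + P) *m (S2 + P).
have uG : G \in unitmx by rewrite unitmx_mul unitmx_inv u1 u2.
have mh : measurable_fun setT (fun z => g (affine_map (S1 + P) 0 z)).
  exact: (measurableT_comp mg (measurable_affine_map _ _)).
have h0 z : (0 <= g (affine_map (S1 + P) 0 z))%E by rewrite lee_fin.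
have := std_normal_affine 0 uG mh h0.
have kE : `|\det G| = k.
  by rewrite /G det_mulmx det_inv normrM normfV mulrC.
rewrite kE => H.
transitivity (\int[gaussian A]_x (\1_X x : R)%:E)%E.
  by rewrite integral_indic// setIT.
rewrite gaussianE//.
transitivity (\int[std_normal m]_z g (affine_map (S1 + P) 0 z))%E.
  by apply: eq_integral => z _; rewrite /g affine_mapM ES1 mulmx0 addr0.
transitivity (\int[gaussian B]_x ((density x)%:E * (\1_X x : R)%:E))%E; last first.
  rewrite [RHS]integral_mkcond; apply: eq_integral => x _.
  rewrite patchE indicE; case: ifPn => _; first by rewrite mule1.
  by rewrite mule0.
rewrite gaussianE//; last 2 first.
- apply: emeasurable_funM => //; exact/measurable_EFinP.
- by move=> x; rewrite mule_ge0// lee_fin// ltW.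
transitivity (k%:E * ((k^-1)%:E *
    \int[std_normal m]_z g (affine_map (S1 + P) 0 z)))%E.
  by rewrite muleA -EFinM divff ?mul1e// gt_eqF.
rewrite -H -ge0_integralZl//; last 3 first.
- apply: emeasurable_funM; last by apply/measurable_EFinP; exact: measurable_gauss_ratio.
  exact: (measurableT_comp mh (measurable_affine_map _ _)).
- by move=> z _; rewrite mule_ge0// lee_fin expR_ge0.
- by rewrite lee_fin ltW.
apply: eq_integral => z _.
have S1G : (S1 + P) *m G = S2 + P by rewrite mulKVmx.
have -> : g (affine_map (S1 + P) 0 (affine_map G 0 z)) = (\1_X (affine_map S2 0 z) : R)%:E.
  by rewrite /g !affine_mapM !mulmx0 !addr0 -mulmxA S1G ES2.
suff dE : density (affine_map S2 0 z) = k * gauss_ratio G 0 z.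
  by rewrite dE (EFinM k (gauss_ratio G 0 z)) [(_ * (gauss_ratio _ _ _)%:E)%E]muleC muleA.
rewrite /density /gauss_ratio /affine_map tuple_ofK !addr0; congr (_ * expR (_ / 2)).
rewrite /sqnorm.
have sqE (x : 'cV[R]_m) : \sum_i x i 0 ^+ 2 = (x^T *m x) 0 0.
  by rewrite dotE; apply: eq_bigr => i _; rewrite expr2.
rewrite !sqE !trmx_mul.
have [[sS1 _] _] := sqrtmxP psdA; have [[sS2 _] _] := sqrtmxP psdB.
(* This matches the exponents: at [x = S2 z] the form [x^T Delta x] equals [|z|^2 - |G z|^2]. *)
have E1 : S2 *m Delta *m S2 = 1%:M - G^T *m G.
  transitivity ((S2 + P) *m Delta *m (S2 + P)).
    rewrite mulmxDl PDelta addr0 (mulmxDr (S2 *m Delta)) -(mulmxA S2 Delta P).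
    by rewrite DeltaP mulmx0 addr0.
  rewrite mulmxBr mulmxBl; congr (_ - _).
    by rewrite -SS2 invmxM// mulmxA mulmxV// mul1mx mulVmx.
  rewrite /G trmx_mul trmx_inv !linearD/= sS1 sS2 PT -SS1 invmxM//.
  by rewrite !mulmxA.
rewrite sS2 -!mulmxA [S2 *m (Delta *m _)]mulmxA [S2 *m Delta *m _]mulmxA E1.
by rewrite mulmxBl mul1mx mulmxBr [LHS]mxE [X in _ + X]mxE /G trmx_mul !mulmxA.
Qed.

Lemma gaussian_idiv : idiv A B = (gauss_div P A B)%:E.
Proof.
rewrite /idiv (kullback_leibler_density measurable_density density_gt0 gaussian_density).
have [S1P PS1 SS1 u1] := kernel_proj_sqrt psdA PA.
have [S2P PS2 SS2 u2] := kernel_proj_sqrt psdB PB.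
have [[sS1 _] SA] := sqrtmxP psdA.
have [PT PP AP pdA] := PA; have [_ _ BP pdB] := PB.
have lnE (x : T) : (ln (density x))%:E =
    (ln k + ((vec_of x)^T *m (2^-1 *: Delta) *m vec_of x) 0 0)%:E.
  congr EFin; rewrite /density lnM ?posrE ?expR_gt0// expRK.
  by rewrite -scalemxAr -scalemxAl [X in _ = _ + X]mxE mulrC.
have mln : measurable_fun setT (fun x => (ln (density x))%:E).
  apply/measurable_EFinP.
  exact: (measurableT_comp (measurable_ln (R := R)) measurable_density).
have iln : (std_normal m).-integrable setT
    ((fun x => (ln (density x))%:E) \o mulmx_tuple S1).
  rewrite (_ : _ \o _ = fun z => (ln k +
      ((vec_of z)^T *m (S1 *m (2^-1 *: Delta) *m S1) *m vec_of z) 0 0)%:E).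
    exact: integrable_std_normal_qform.
  apply/funext => z; rewrite [LHS]lnE mulmx_tupleE /affine_map tuple_ofK addr0.
  by rewrite trmx_mul sS1 !mulmxA.
rewrite [LHS](integral_distribution mln iln).
transitivity (\int[std_normal m]_z (ln (density (affine_map S1 0 z)))%:E)%E.
  by apply: eq_integral => z _; rewrite -(mulmx_tupleE S1).
under eq_integral => z _.
  rewrite lnE /affine_map tuple_ofK addr0 trmx_mul sS1 -!mulmxA.
  rewrite [S1 *m (_ *m _)]mulmxA [S1 *m _ *m (_ *m _)]mulmxA mulmxA.
  over.
rewrite integral_std_normal_qform; congr EFin.
have detS (C : 'M[R]_m) : C \in unitmx -> ln (\det (C *m C)) = 2 * ln `|\det C|.
  rewrite unitmxE unitfE => c0; have c1 : 0 < `|\det C| by rewrite normr_gt0.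
  by rewrite det_mulmx -expr2 -real_normK ?num_real// lnXn// mulr_natl.
rewrite /gauss_div -SS1 -SS2 !detS// SS2.
rewrite /k ln_div ?posrE ?normr_gt0 -?unitfE -?unitmxE//.
have trE : \tr (S1 *m (2^-1 *: Delta) *m S1) = \tr (Delta *m A) / 2.
  rewrite mxtrace_mulC mulmxA SA mxtrace_mulC -scalemxAl mxtraceZ.
  by rewrite mulrC.
(* Both [(A + P)^-1 A] and [(B + P)^-1 B] equal [1 - P]. *)
rewrite trE; suff -> : \tr (Delta *m A) = \tr (invmx (B + P) *m (A - B)) by field.
rewrite mulmxBl mulmxBr !raddfB /=; congr (_ - _).
have uA := pd_unit pdA; have uB := pd_unit pdB.
have iE (C : 'M[R]_m) : C + P \in unitmx -> invmx (C + P) *m P = P ->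
    invmx (C + P) *m C = 1%:M - P.
  by move=> uC CP; rewrite -[C in X in _ *m X](addrK P) mulmxBr mulVmx// CP.
by rewrite !iE// ?(kernel_proj_inv psdA PA).1 ?(kernel_proj_inv psdB PB).1.
Qed.

End gaussian_idiv.

(** * Kernels and generalized inverses *)

Section kernels.
Context {R : realType}.

Lemma diagpartE m (A : 'M[R]_m) i j : diagpart A i j = A i i *+ (i == j).
Proof. by rewrite !mxE; case: eqP => // ->. Qed.

Lemma diagpart_diag m (A : 'M[R]_m) : is_diag_mx (diagpart A).
Proof. exact: diag_mx_is_diag. Qed.

Lemma is_diag_mulmx m (D : 'M[R]_m) (x : 'cV[R]_m) i :
  is_diag_mx D -> (D *m x) i 0 = D i i * x i 0.
Proof.
move=> /is_diag_mxP dD; rewrite mxE (bigD1 i)//= big1 ?addr0// => j ji.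
by rewrite dD ?mul0r// eq_sym.
Qed.

Lemma psd_diag_ge0 m (A : 'M[R]_m) i : psdmx A -> 0 <= A i i.
Proof.
move=> [_ /(_ (delta_mx i 0))]; rewrite -mulmxA -colE trmx_delta -rowE.
by rewrite !mxE.
Qed.

Lemma psd_diag0 m (A : 'M[R]_m) i : psdmx A -> A i i = 0 -> col i A = 0.
Proof.
move=> pA Aii; rewrite colE; apply: psd_qform0 => //.
by rewrite -mulmxA -colE trmx_delta -rowE !mxE.
Qed.

Lemma psd_diagpart m (A : 'M[R]_m) : psdmx A -> psdmx (diagpart A).
Proof.
move=> pA; split=> [|x]; first by rewrite tr_diag_mx.
rewrite -mulmxA dotE sumr_ge0// => i _.
rewrite is_diag_mulmx ?diagpart_diag// diagpartE eqxx mulrCA -expr2.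
by rewrite mulr_ge0// ?sqr_ge0// psd_diag_ge0.
Qed.

Lemma pd_diagpart m (A : 'M[R]_m) : pdmx A -> pdmx (diagpart A).
Proof.
move=> pA; apply: psd_unit_pd; first exact/psd_diagpart/pd_psd.
rewrite unitmxE det_diag unitfE; apply/prodf_neq0 => i _; rewrite mxE.
have := pA.2 (delta_mx i 0); rewrite -mulmxA -colE trmx_delta -rowE !mxE.
move=> H; rewrite gt_eqF// H//; apply/eqP => /matrixP/(_ i 0)/eqP.
by rewrite !mxE !eqxx oner_eq0.
Qed.

Lemma mulmx_sum_cols m (A : 'M[R]_m) (x : 'cV[R]_m) : A *m x = \sum_i x i 0 *: col i A.
Proof.
apply/colP => i; rewrite !mxE summxE; apply: eq_bigr => j _.
by rewrite !mxE mulrC.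
Qed.

(** A zero diagonal entry of a nonnegative matrix annihilates its whole column. *)
Lemma diagpart_ker m (A : 'M[R]_m) (x : 'cV[R]_m) :
  psdmx A -> diagpart A *m x = 0 -> A *m x = 0.
Proof.
move=> pA Ax; rewrite mulmx_sum_cols big1// => i _.
have [->|x0] := eqVneq (x i 0) 0; first by rewrite scale0r.
rewrite psd_diag0 ?scaler0//; move/colP/(_ i): Ax.
rewrite is_diag_mulmx ?diagpart_diag// diagpartE eqxx mxE => /eqP.
by rewrite mulf_eq0 (negbTE x0) orbF => /eqP.
Qed.

Lemma psd_add_ker m (A B : 'M[R]_m) (x : 'cV[R]_m) : psdmx A -> psdmx B ->
  (A + B) *m x = 0 -> A *m x = 0 /\ B *m x = 0.
Proof.
move=> pA pB ABx.
have : (x^T *m A *m x) 0 0 + (x^T *m B *m x) 0 0 = 0.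
  transitivity ((x^T *m ((A + B) *m x)) 0 0); last by rewrite ABx mulmx0 mxE.
  by rewrite mulmxDl mulmxDr [RHS]mxE !mulmxA.
move/eqP; rewrite paddr_eq0; [|exact: pA.2|exact: pB.2].
by move=> /andP[/eqP Ax /eqP Bx]; split; apply: psd_qform0.
Qed.

Lemma inj_unitmx m (A : 'M[R]_m) :
  (forall x : 'cV[R]_m, A *m x = 0 -> x = 0) -> A \in unitmx.
Proof.
move=> iA; rewrite -unitmx_tr -row_free_unit -kermx_eq0.
apply/rowV0P => v /sub_kermxP vA; apply: trmx_inj; rewrite trmx0; apply: iA.
by apply: trmx_inj; rewrite trmx_mul trmxK vA trmx0.
Qed.

Definition same_ker m (A B : 'M[R]_m) := forall x : 'cV[R]_m, A *m x = 0 <-> B *m x = 0.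

Lemma exists_kernel_proj m (A : 'M[R]_m) : psdmx A -> exists P, kernel_proj P A.
Proof.
move=> pA; have [sA _] := pA.
have [r [K [KA Kfree Kmax]]] : exists r (K : 'M[R]_(r, m)), [/\ K *m A = 0,
    row_free K & forall v : 'rV_m, v *m A = 0 -> (v <= K)%MS].
  exists (\rank (kermx A)), (row_base (kermx A)); split; last 2 first.
  - exact: row_base_free.
  - by move=> v vA; rewrite eq_row_base; apply/sub_kermxP.
  - by apply/sub_kermxP; rewrite eq_row_base.
have KKpd : pdmx (K *m K^T).
  rewrite (_ : K *m K^T = (K^T)^T *m 1%:M *m K^T); last by rewrite trmxK mulmx1.
  apply: pd_congr.
    move=> x Kx; apply: trmx_inj; rewrite trmx0; apply/eqP.
    by rewrite -(mulmx_free_eq0 _ Kfree) -trmx0 -Kx trmx_mul trmxK.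
  split=> [|x x0]; first exact: trmx1.
  by rewrite mulmx1; exact: dot_gt0.
have uK := pd_unit KKpd.
(* The orthogonal projector on the row space of [K], whose independent rows span the kernel of
   [A]. *)
pose P := K^T *m invmx (K *m K^T) *m K.
have PT : P^T = P.
  by rewrite /P trmx_mul [(_ *m invmx _)^T]trmx_mul trmx_inv (KKpd.1) trmxK mulmxA.
have PP : P *m P = P.
  by rewrite /P -!mulmxA [K *m (K^T *m _)]mulmxA mulKmx.
have PA0 : P *m A = 0 by rewrite -mulmxA KA mulmx0.
have AP0 : A *m P = 0 by apply: trmx_inj; rewrite trmx_mul sA PT PA0 trmx0.
have pP : psdmx P by rewrite -PP -{1}PT; exact: gram_psd.
exists P; split=> //; apply: psd_unit_pd; first exact: psd_add.
apply: inj_unitmx => x /(psd_add_ker pA pP)[Ax Px].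
have /submxP[w wE] : (x^T <= K)%MS.
  by apply: Kmax; apply: trmx_inj; rewrite trmx_mul trmxK sA Ax trmx0.
have : P *m x = x.
  apply: trmx_inj; rewrite trmx_mul PT wE /P !mulmxA -[w *m K *m K^T]mulmxA mulmxK//.
by rewrite Px => <-.
Qed.

Lemma same_ker_proj m (P A B : 'M[R]_m) : psdmx A -> psdmx B -> same_ker A B ->
  kernel_proj P A -> kernel_proj P B.
Proof.
move=> pA pB AB [PT PP AP pd]; split=> //.
  apply/matrixP => i j; have : A *m col j P = 0 by rewrite colE mulmxA AP mul0mx.
  by move/AB; rewrite colE mulmxA -colE => /colP/(_ i); rewrite !mxE.
have pP : psdmx P by rewrite -PP -{1}PT; exact: gram_psd.
apply: psd_unit_pd; first exact: psd_add.
apply: inj_unitmx => x /(psd_add_ker pB pP)[/AB Ax Px].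
by rewrite -[x](mulKmx (pd_unit pd)) mulmxDl Ax Px addr0 mulmx0.
Qed.

Lemma kernel_proj_mull m (P A : 'M[R]_m) : psdmx A -> kernel_proj P A -> P *m A = 0.
Proof. by move=> [sA _] [PT _ AP _]; apply: trmx_inj; rewrite trmx_mul sA PT AP trmx0. Qed.

(** Since [A] and [B] vanish on the range of [P], [A - B = B X B] for some [X]; the trace against
    any [G] with [B G B = B] is then that of [X B]. *)
Lemma trace_ginverse m (P A B G : 'M[R]_m) : psdmx A -> psdmx B ->
  kernel_proj P A -> kernel_proj P B -> B *m G *m B = B ->
  \tr (invmx (B + P) *m (A - B)) = \tr (G *m (A - B)).
Proof.
move=> pA pB kA kB BGB; have [PT PP BP pd] := kB; have [_ _ AP _] := kA.
have uB := pd_unit pd; pose W := invmx (B + P).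
have [WP PW] := kernel_proj_inv pB kB.
have WB : W *m B = 1%:M - P.
  by rewrite -[B in X in _ *m X](addrK P) mulmxBr mulVmx// WP.
have BW : B *m W = 1%:M - P.
  by rewrite -[B in X in X *m _](addrK P) mulmxBl mulmxV// PW.
pose X := W *m (A - B) *m W.
have PAB : P *m (A - B) = 0 by rewrite mulmxBr !kernel_proj_mull// subrr.
have ABP : (A - B) *m P = 0 by rewrite mulmxBl AP BP subrr.
have E : A - B = B *m X *m B.
  rewrite /X !mulmxA BW -[RHS]mulmxA WB.
  by rewrite mulmxBl mul1mx PAB subr0 mulmxBr mulmx1 ABP subr0.
have PX : P *m X = 0 by rewrite /X !mulmxA PW PAB mul0mx.
clearbody X; rewrite -/W E !mulmxA WB mulmxBl mul1mx PX subr0.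
by rewrite mxtrace_mulC [RHS]mxtrace_mulC !mulmxA BGB.
Qed.

(** Sylvester's identity, from two block triangular factorizations of the same matrix. *)
Lemma det_1DmulC m p (A : 'M[R]_(m, p)) (B : 'M[R]_(p, m)) :
  \det (1%:M + A *m B) = \det (1%:M + B *m A).
Proof.
pose X := block_mx 1%:M (- A) B 1%:M.
have E1 : X = block_mx 1%:M 0 B 1%:M *m block_mx 1%:M (- A) 0 (1%:M + B *m A).
  by rewrite mulmx_block !mul1mx !mul0mx !mulmx1 !addr0 mulmxN [_ + (1%:M + _)]addrC addrK.
have E2 : X = block_mx (1%:M + A *m B) (- A) 0 1%:M *m block_mx 1%:M 0 B 1%:M.
  rewrite mulmx_block !mul1mx !mul0mx !mulmx1 !mulmx0 add0r mulNmx addrK add0r.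
  by rewrite add0r.
have := congr1 determinant E1; rewrite E2 !det_mulmx.
by rewrite !(det_lblock, det_ublock) !det1 !mulr1 !mul1r.
Qed.

End kernels.

(** * One step of the algorithm *)

Section one_step.
Context {R : realType} {n k : nat}.
Variables (Sigma : 'M[R]_n) (H : 'M[R]_(n, k)) (D : 'M[R]_n).
Hypothesis Sigma_pd : pdmx Sigma.
Hypothesis D_diag : is_diag_mx D.
Hypothesis D_psd : psdmx D.
Hypothesis S_pd : pdmx (fa_cov H D).

Local Notation S := (fa_cov H D).
Local Notation Rt := (fa_R Sigma H D).

Definition fa_H : 'M[R]_(n, k) :=
  Sigma *m invmx S *m H *m invmx (sqrtmx Rt).

(* The Schur complement of fa_R in fa_Sigma0 (for Q = 1). *)
Definition fa_residual : 'M[R]_n := Sigma - fa_H *m fa_H^T.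

Let G := invmx S *m H.
Let uS : S \in unitmx := pd_unit S_pd.
Let sS : S^T = S := S_pd.1.
Let sSigma : Sigma^T = Sigma := Sigma_pd.1.

(** The conditional covariance of a standard normal factor [x] given the observation [H x + noise],
    the noise having covariance [D]. *)
Let K : 'M[R]_k := 1%:M - H^T *m G.

Let GT : G^T = H^T *m invmx S.
Proof. by rewrite trmx_mul trmx_inv sS. Qed.

Let KT : K^T = K.
Proof. by rewrite linearB/= trmx1 trmx_mul trmxK GT -mulmxA. Qed.

(** With [X = H^T G] and [D = S - H H^T], both sides reduce to [1 - X]. This shows [K] nonnegative,
    and locates its kernel, for singular [D] as well. *)
Let KE : K = K *m K + G^T *m D *m G.
Proof.
have -> : D = S - H *m H^T by rewrite /fa_cov addrC addKr.
have E : G^T *m S *m G = H^T *m G by rewrite GT -[_ *m S]mulmxA mulVmx// mulmx1.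
rewrite (mulmxBr G^T) (mulmxBl (G^T *m S)) E.
have -> : G^T *m (H *m H^T) *m G = (H^T *m G) *m (H^T *m G) by rewrite GT !mulmxA.
rewrite /K; move: (H^T *m G) => X.
by rewrite mulmxBl mul1mx mulmxBr mulmx1 subrK.
Qed.

Let RE : Rt = K + G^T *m Sigma *m G.
Proof. by rewrite /fa_R GT /K !mulmxA. Qed.

Let Kpsd : psdmx K.
Proof.
by rewrite KE; apply: psd_add; [rewrite -{1}KT; exact: gram_psd|exact: psd_congr].
Qed.

Let K_ker (y : 'cV[R]_k) : K *m y = 0 -> D *m (G *m y) = 0.
Proof.
have p1 : psdmx (K *m K) by rewrite -{1}KT; exact: gram_psd.
have p2 : psdmx (G^T *m D *m G) by exact: psd_congr.
rewrite {1}KE => /(psd_add_ker p1 p2)[_].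
move=> /(congr1 (fun v => (y^T *m v) 0 0)); rewrite mulmx0 [RHS]mxE => E.
apply: psd_qform0 => //; rewrite -[RHS]E trmx_mul !mulmxA//.
Qed.

(** A kernel vector [y] is annihilated by both [K] and [G^T Sigma G]; the latter gives [G y = 0],
    and then [K y = y]. *)
Lemma fa_R_pd : pdmx Rt.
Proof.
have pR : psdmx Rt by rewrite RE; apply: psd_add => //; apply/psd_congr/pd_psd.
apply: psd_unit_pd => //; apply: inj_unitmx => y.
rewrite RE => /(psd_add_ker Kpsd (psd_congr _ (pd_psd Sigma_pd)))[Ky Gy].
have G0 : G *m y = 0.
  have : (G *m y)^T *m Sigma *m (G *m y) = 0.
    rewrite -[RHS](mulmx0 _ y^T) -Gy trmx_mul !mulmxA//.
  move=> /matrixP/(_ 0 0); rewrite [RHS]mxE => /(psd_qform0 (pd_psd Sigma_pd)) E.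
  by rewrite -[LHS](mulKmx (pd_unit Sigma_pd)) E mulmx0.
by move: Ky; rewrite mulmxBl mul1mx -mulmxA G0 mulmx0 subr0.
Qed.

Let uR := pd_unit fa_R_pd.

Lemma sqrt_fa_R : [/\ (sqrtmx Rt)^T = sqrtmx Rt, sqrtmx Rt *m sqrtmx Rt = Rt
  & sqrtmx Rt \in unitmx].
Proof.
have [[sB _] BB] := sqrtmxP (pd_psd fa_R_pd); split=> //.
by move: uR; rewrite -{1}BB unitmx_mul => /andP[].
Qed.

Let Y : 'M[R]_(k, n) := invmx Rt *m G^T *m Sigma.

Let HHE : fa_H *m fa_H^T = Sigma *m G *m Y.
Proof.
have [sB BB uB] := sqrt_fa_R.
rewrite /fa_H trmx_mul trmx_inv sB mulmxA -[_ *m invmx _ *m invmx _]mulmxA.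
rewrite -invmxM// BB /Y GT !trmx_mul sSigma trmx_inv sS !mulmxA//.
Qed.

(** Completing the square with [R = K + G^T Sigma G]; [Y^T = Sigma G R^-1] is the regression
    coefficient of the observations on the factors under [Sigma_0]. Nonnegativity and the kernel are
    read off from the two terms. *)
Let residualE :
  fa_residual = (1%:M - G *m Y)^T *m Sigma *m (1%:M - G *m Y) + Y^T *m K *m Y.
Proof.
have RY : Rt *m Y = G^T *m Sigma by rewrite /Y -!mulmxA mulKVmx.
have YR : Y^T *m Rt = Sigma *m G.
  by apply: trmx_inj; rewrite (trmx_mul Y^T) trmxK fa_R_pd.1 RY (trmx_mul Sigma) sSigma.
rewrite /fa_residual HHE.
have -> : K = Rt - G^T *m Sigma *m G by rewrite RE addrK.
have -> : (1%:M - G *m Y)^T *m Sigma = Sigma - Sigma *m G *m Y.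
  rewrite linearB/= trmx1 trmx_mul mulmxBl mul1mx; congr (_ - _).
  by rewrite -(mulmxA Y^T) -RY (mulmxA Y^T) YR.
rewrite (mulmxBr _ 1%:M) mulmx1 (mulmxBr Y^T) (mulmxBl (Y^T *m Rt)) YR.
have -> : Y^T *m (G^T *m Sigma *m G) *m Y = Sigma *m G *m Y *m (G *m Y).
  by rewrite -RY (mulmxA Y^T) (mulmxA Y^T) YR -(mulmxA _ G Y).
by rewrite (mulmxBl Sigma) (mulmxA Sigma G Y) subrK.
Qed.

Let residual_terms : psdmx ((1%:M - G *m Y)^T *m Sigma *m (1%:M - G *m Y)) /\
  psdmx (Y^T *m K *m Y).
Proof. by split; [exact/psd_congr/pd_psd|exact: psd_congr]. Qed.

Lemma fa_residual_psd : psdmx fa_residual.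
Proof. by rewrite residualE; case: residual_terms; exact: psd_add. Qed.

Let residual_ker (x : 'cV[R]_n) : fa_residual *m x = 0 ->
  x = G *m (Y *m x) /\ K *m (Y *m x) = 0.
Proof.
rewrite residualE => /(psd_add_ker residual_terms.1 residual_terms.2)[E1 E2].
have form p (A : 'M[R]_p) (B : 'M[R]_(p, n)) : psdmx A ->
    B^T *m A *m B *m x = 0 -> A *m (B *m x) = 0.
  move=> pA E; apply: psd_qform0 => //.
  have -> : (B *m x)^T *m A *m (B *m x) = x^T *m (B^T *m A *m B *m x).
    by rewrite trmx_mul !mulmxA.
  by rewrite E mulmx0 mxE.
split; last exact: (form _ _ _ Kpsd).
have := form _ _ _ (pd_psd Sigma_pd) E1.
move=> /(congr1 (mulmx (invmx Sigma))); rewrite mulKmx ?(pd_unit Sigma_pd)// mulmx0.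
by rewrite mulmxBl mul1mx -mulmxA => /eqP; rewrite subr_eq0 => /eqP.
Qed.

(** If both squares vanish at [x], then [x = G y] with [K y = 0] for [y = Y x], so [D x = 0].
    Conversely [D x = 0] gives [S x = H H^T x], hence [x = G y] with [y = H^T x], and the same
    relations hold. *)
Lemma fa_residual_ker : same_ker fa_residual D.
Proof.
move=> x; split=> [/residual_ker[xE /K_ker]|Dx]; first by rewrite -xE.
pose y := H^T *m x.
have Gy : G *m y = x.
  have Sx : S *m x = H *m y by rewrite mulmxDl Dx addr0 -mulmxA.
  by rewrite -mulmxA -Sx mulKmx.
have Ky : K *m y = 0 by rewrite mulmxBl mul1mx -mulmxA Gy subrr.
have Yx : Y *m x = y.
  have E : G^T *m (Sigma *m x) = Rt *m y.
    by rewrite RE mulmxDl Ky add0r -(mulmxA _ G y) Gy -(mulmxA G^T).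
  by rewrite /Y -(mulmxA _ Sigma x) -(mulmxA _ G^T) E mulKmx.
by rewrite mulmxBl HHE -(mulmxA _ Y x) Yx -mulmxA Gy subrr.
Qed.

Lemma fa_residual_pd : pdmx D -> pdmx fa_residual.
Proof.
move=> pD; apply: psd_unit_pd; first exact: fa_residual_psd.
apply: inj_unitmx => x /fa_residual_ker Dx.
by rewrite -[x](mulKmx (pd_unit pD)) Dx mulmx0.
Qed.

(* The zero pattern of D never changes, so that for singular D all the laws
   N(0, Sigma_1,t) and N(0, Sigma_0,t) live on one subspace. *)
Lemma fa_next_ker : same_ker (diagpart fa_residual) D.
Proof.
move=> x; split=> [/(diagpart_ker fa_residual_psd)/fa_residual_ker//|Dx].
apply/colP => i; rewrite is_diag_mulmx ?diagpart_diag// diagpartE eqxx mulr1n [RHS]mxE.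
have [->|xi] := eqVneq (x i 0) 0; first by rewrite mulr0.
(* As [D] is diagonal, [x_i != 0] forces [D_ii = 0]; the basis vector [e_i] then lies in the kernel
   of the residual too. *)
have : D *m delta_mx i (0 : 'I_1) = 0.
  apply/colP => j; rewrite is_diag_mulmx// !mxE eqxx andbT.
  have [->|_] := eqVneq j i; last by rewrite mulr0.
  move/colP/(_ i): Dx; rewrite is_diag_mulmx// mxE => /eqP.
  by rewrite mulf_eq0 (negbTE xi) orbF => /eqP ->; rewrite mul0r.
move/fa_residual_ker; rewrite -colE => /colP/(_ i); rewrite mxE [RHS]mxE => ->.
by rewrite mul0r.
Qed.

(** A vector annihilated by [fa_H *m fa_H^T] and by the residual is annihilated by their sum
    [Sigma]. *)
Lemma fa_next_cov_pd : pdmx (fa_cov fa_H (diagpart fa_residual)).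
Proof.
have p1 : psdmx (fa_H *m fa_H^T) by rewrite -{1}[fa_H]trmxK; exact: gram_psd.
have p2 := psd_diagpart fa_residual_psd.
apply: psd_unit_pd; first exact: psd_add.
apply: inj_unitmx => x /(psd_add_ker p1 p2)[Hx /(diagpart_ker fa_residual_psd)].
rewrite mulmxBl Hx subr0 => Sx.
by rewrite -[x](mulKmx (pd_unit Sigma_pd)) Sx mulmx0.
Qed.

Lemma fa_cov_fixed : S = Sigma -> fa_H = H /\ diagpart fa_residual = D.
Proof.
move=> SE; have R1 : Rt = 1%:M.
  rewrite /fa_R SE -[_ *m Sigma]mulmxA mulVmx ?mulmx1 ?subrK//.
  exact: pd_unit.
have HE : fa_H = H.
  rewrite /fa_H R1 sqrtmx1 invmx1 mulmx1 SE mulmxV ?mul1mx//.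
  exact: pd_unit.
split=> //; rewrite /fa_residual HE -SE /fa_cov addrC addKr.
apply/matrixP => i j; rewrite diagpartE.
have [->//|ij] := eqVneq i j.
by rewrite (is_diag_mxP D_diag i j ij).
Qed.

End one_step.

(** * The joint covariances of observations and factors *)

Section joint_covariance.
Context {R : realType} {n k : nat}.
Implicit Types (H : 'M[R]_(n, k)) (X D : 'M[R]_n) (Q : 'M[R]_k).

(** The linear map taking independent noise and standard factors [(e, x)] to [(H x + e, Q^T x)],
    whose covariance is [fa_Sigma1]. *)
Definition joint_factor H Q : 'M[R]_(n + k) := block_mx 1%:M H 0 Q^T.

Definition first_block : 'M[R]_(n + k, n) := col_mx 1%:M 0.

Lemma fa_Sigma1E H X Q : fa_Sigma1 H X Q =
  joint_factor H Q *m block_mx X 0 0 1%:M *m (joint_factor H Q)^T.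
Proof.
rewrite /joint_factor tr_block_mx trmx1 trmx0 trmxK !mulmx_block.
rewrite !mul1mx !mul0mx !mulmx0 !mulmx1 !addr0 !add0r /fa_Sigma1 /fa_cov trmx_mul.
by congr block_mx; rewrite addrC.
Qed.

Lemma joint_factor_unit H Q : Q \in unitmx -> joint_factor H Q \in unitmx.
Proof. by move=> uQ; rewrite unitmxE det_ublock det1 mul1r -unitmxE unitmx_tr. Qed.

Lemma fa_Sigma1_psd H X Q : psdmx X -> psdmx (fa_Sigma1 H X Q).
Proof.
move=> [sX pX]; rewrite fa_Sigma1E -{1}[joint_factor H Q]trmxK; apply: psd_congr.
split=> [|x]; first by rewrite tr_block_mx !trmx0 trmx1 sX.
rewrite -[x]vsubmxK tr_col_mx mul_row_block !mulmx0 !addr0 !add0r mul_row_col mulmx1.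
by rewrite mxE addr_ge0// dot_ge0.
Qed.

Lemma fa_Sigma1_ker H X X' Q : Q \in unitmx -> same_ker X X' ->
  same_ker (fa_Sigma1 H X Q) (fa_Sigma1 H X' Q).
Proof.
move=> uQ XX'.
have half Z (x : 'cV[R]_(n + k)) : fa_Sigma1 H Z Q *m x = 0 <->
    Z *m usubmx ((joint_factor H Q)^T *m x) = 0 /\ dsubmx ((joint_factor H Q)^T *m x) = 0.
  rewrite fa_Sigma1E -!mulmxA.
  set y := (joint_factor H Q)^T *m x.
  rewrite -[X in block_mx Z 0 0 1%:M *m X](vsubmxK y) mul_block_col !mul0mx mul1mx addr0 add0r.
  split=> [/(congr1 (mulmx (invmx (joint_factor H Q))))|[-> ->]].
    rewrite mulKmx ?joint_factor_unit// mulmx0 => /eqP.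
    by rewrite -col_mx0 => /eqP/eq_col_mx[-> ->].
  by rewrite col_mx0 mulmx0.
by move=> x; split=> /half[] /XX' Z D; apply/half.
Qed.

Lemma same_ker_trans m (A B C : 'M[R]_m) : same_ker A B -> same_ker B C -> same_ker A C.
Proof. by move=> AB BC x; split=> [/AB/BC|/BC/AB]. Qed.

Lemma same_ker_sym m (A B : 'M[R]_m) : same_ker A B -> same_ker B A.
Proof. by move=> AB x; split=> /AB. Qed.

(* A generalized inverse of fa_Sigma1 H D Q for diagonal D, thanks to 0^-1 = 0. *)
Definition joint_ginv H D Q : 'M[R]_(n + k) :=
  (invmx (joint_factor H Q))^T *m block_mx (diag_mx (\row_i (D i i)^-1)) 0 0 1%:M
  *m invmx (joint_factor H Q).

Lemma joint_ginvP H D Q : Q \in unitmx -> is_diag_mx D ->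
  fa_Sigma1 H D Q *m joint_ginv H D Q *m fa_Sigma1 H D Q = fa_Sigma1 H D Q.
Proof.
move=> uQ dD; have uT := joint_factor_unit H uQ; have uT' : (joint_factor H Q)^T \in unitmx.
  by rewrite unitmx_tr.
rewrite fa_Sigma1E /joint_ginv trmx_inv; set T := joint_factor H Q.
rewrite !mulmxA (mulmxK uT') -[_ *m invmx T *m T]mulmxA mulVmx// mulmx1.
congr (_ *m _); rewrite -!mulmxA; congr (_ *m _).
rewrite !mulmx_block !mulmx0 !mul0mx !mulmx1 !addr0 !add0r.
congr block_mx; rewrite ?mulmx0 ?mulmx1//.
have DE : D = diag_mx (\row_i D i i).
  apply/matrixP => i j; rewrite !mxE; have [<-//|ij] := eqVneq i j.
  exact: (is_diag_mxP dD i j ij).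
rewrite DE !mulmx_diag; congr diag_mx; apply/rowP => i; rewrite !mxE eqxx mulr1n.
by have [->|d0] := eqVneq (D i i) 0; rewrite ?mul0r// mulVf// mulr1.
Qed.

Lemma joint_factor_first H Q : joint_factor H Q *m first_block = first_block.
Proof. by rewrite mul_block_col !mulmx1 !mulmx0 !addr0. Qed.

(** [joint_factor] fixes [first_block], so [H] and [Q] disappear from the first block of the
    generalized inverse. A first-block matrix with zero diagonal therefore has trace zero against
    it. *)
Lemma joint_ginv_first H D Q : Q \in unitmx ->
  first_block^T *m joint_ginv H D Q *m first_block = diag_mx (\row_i (D i i)^-1).
Proof.
move=> uQ; have uT := joint_factor_unit H uQ.
have TJ : invmx (joint_factor H Q) *m first_block = first_block.
  by rewrite -{1}(joint_factor_first H Q) mulKmx.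
rewrite /joint_ginv !mulmxA -trmx_mul TJ -[LHS]mulmxA TJ.
rewrite /first_block tr_col_mx trmx1 trmx0 mul_row_block mul_row_col.
by rewrite !mul1mx !mul0mx !mulmx1 !mulmx0 !addr0.
Qed.

Lemma fa_Sigma1_first H X Q :
  fa_Sigma1 H X Q *m first_block = col_mx (fa_cov H X) (H *m Q)^T.
Proof. by rewrite mul_block_col !mulmx1 !mulmx0 !addr0. Qed.

Lemma first_fa_Sigma1_first H X Q :
  first_block^T *m fa_Sigma1 H X Q *m first_block = fa_cov H X.
Proof.
rewrite -mulmxA fa_Sigma1_first tr_col_mx trmx1 trmx0 mul_row_col mul1mx.
by rewrite mul0mx addr0.
Qed.

Lemma first_block_conj X : first_block *m X *m first_block^T = block_mx X 0 0 0.
Proof.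
rewrite /first_block mul_col_mx mul1mx mul0mx tr_col_mx trmx1 trmx0 mul_col_row.
by rewrite !mulmx1 !mulmx0.
Qed.

Lemma trace_diag_off (d : 'rV[R]_n) X : (forall i, X i i = 0) -> \tr (diag_mx d *m X) = 0.
Proof.
move=> X0; rewrite /mxtrace big1// => i _.
by rewrite mul_diag_mx mxE X0 mulr0.
Qed.

End joint_covariance.

Section divergence_decrease.
Context {R : realType} {n k : nat}.
Variables (Sigma : 'M[R]_n) (H : 'M[R]_(n, k)) (D : 'M[R]_n) (Q : 'M[R]_k).
Hypothesis Sigma_pd : pdmx Sigma.
Hypothesis D_diag : is_diag_mx D.
Hypothesis D_psd : psdmx D.
Hypothesis S_pd : pdmx (fa_cov H D).
Hypothesis uQ : Q \in unitmx.

Let S := fa_cov H D.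
Let H1 := fa_H Sigma H D.
Let M := fa_residual Sigma H D.
Let D1 := diagpart M.
Let Q1 := sqrtmx (fa_R Sigma H D) *m Q.

(** [Sigma_0,t] already has the form of [Sigma_1,t+1], with the full residual where the latter has
    its diagonal part. Everything about [fa_Sigma1] with a general noise covariance thus applies to
    it. *)
Lemma fa_Sigma0_residual : fa_Sigma0 Sigma H D Q = fa_Sigma1 H1 M Q1.
Proof.
have [sB BB uB] := sqrt_fa_R Sigma_pd D_psd S_pd.
have HQ : H1 *m Q1 = Sigma *m invmx S *m H *m Q.
  by rewrite /H1 /fa_H /Q1 !mulmxA mulmxKV.
rewrite /fa_Sigma0 /fa_Sigma1 HQ; congr block_mx.
- by rewrite /fa_cov /M /fa_residual addrC subrK.
- by rewrite !trmx_mul trmx_inv (S_pd.1) (Sigma_pd.1) !mulmxA.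
- by rewrite /Q1 trmx_mul sB mulmxA -[Q^T *m _ *m sqrtmx _]mulmxA BB.
Qed.

(** The inner matrix [C] is the solution of [S + S C S = Sigma], which puts [Sigma] in the first
    block. *)
Definition fa_update : 'M[R]_(n + k) :=
  first_block *m (invmx S *m Sigma *m invmx S - invmx S) *m first_block^T.

Lemma fa_Sigma0E : fa_Sigma0 Sigma H D Q =
  fa_Sigma1 H D Q + fa_Sigma1 H D Q *m fa_update *m fa_Sigma1 H D Q.
Proof.
have uS := pd_unit S_pd; have sS := S_pd.1.
have sA : (fa_Sigma1 H D Q)^T = fa_Sigma1 H D Q := (fa_Sigma1_psd H Q D_psd).1.
rewrite /fa_update !mulmxA fa_Sigma1_first -[_ *m first_block^T *m _]mulmxA.
rewrite -[X in _ *m (_ *m X)]sA -trmx_mul fa_Sigma1_first tr_col_mx trmxK sS.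
rewrite -/S mul_col_mx mul_col_row /fa_Sigma0 /fa_Sigma1 add_block_mx -/S.
set C := _ - invmx S.
have SC : S *m C = Sigma *m invmx S - 1%:M.
  by rewrite mulmxBr mulmxV// !mulmxA mulmxV// mul1mx.
have CS : C *m S = invmx S *m Sigma - 1%:M by rewrite mulmxBl mulVmx// mulmxKV.
congr block_mx.
- by rewrite SC mulmxBl mul1mx mulmxKV// addrC subrK.
- by rewrite SC mulmxBl mul1mx addrC !mulmxA subrK.
- by rewrite -(mulmxA _ C S) CS mulmxBr mulmx1 addrC subrK trmx_mul !mulmxA.
- rewrite /C trmx_mul (mulmxBr (Q^T *m H^T)) mulmxBl !mulmxA addrA addrAC.
  by rewrite /fa_R -/S mulmxDr mulmxBr mulmx1 mulmxDl mulmxBl !mulmxA.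
Qed.

Local Notation A1 := (fa_Sigma1 H D Q).
Local Notation A0 := (fa_Sigma0 Sigma H D Q).

Let uS : S \in unitmx := pd_unit S_pd.
Let uSigma : Sigma \in unitmx := pd_unit Sigma_pd.

(** Sylvester's identity reduces this to the [n x n] determinant of [1 + S C = Sigma S^-1]. *)
Let det_update : \det (1%:M + A1 *m fa_update) = \det Sigma / \det S.
Proof.
rewrite /fa_update !mulmxA det_1DmulC !mulmxA first_fa_Sigma1_first -/S.
rewrite mulmxBr mulmxV// !mulmxA mulmxV// mul1mx addrC subrK.
by rewrite det_mulmx det_inv.
Qed.

Let A0E : A0 = (1%:M + A1 *m fa_update) *m A1.
Proof. by rewrite fa_Sigma0E mulmxDl mul1mx. Qed.

Lemma fa_Sigma0_psd : psdmx A0.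
Proof. by rewrite fa_Sigma0_residual; exact/fa_Sigma1_psd/fa_residual_psd. Qed.

Lemma fa_Sigma0_ker : same_ker A1 A0.
Proof.
move=> x; rewrite A0E -mulmxA; split=> [->|E]; first by rewrite mulmx0.
have u : 1%:M + A1 *m fa_update \in unitmx.
  rewrite unitmxE det_update unitfE mulf_neq0 ?invr_eq0 -?unitfE -?unitmxE//.
by rewrite -[LHS](mulKmx u) E mulmx0.
Qed.

Lemma fa_Sigma1_next_ker : same_ker A1 (fa_Sigma1 H1 D1 Q1).
Proof.
apply: same_ker_trans fa_Sigma0_ker _; rewrite fa_Sigma0_residual.
have [_ _ uB] := sqrt_fa_R Sigma_pd D_psd S_pd.
apply: fa_Sigma1_ker; first by rewrite unitmx_mul uB.
apply: (same_ker_trans (fa_residual_ker Sigma_pd D_psd S_pd)).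
exact/same_ker_sym/fa_next_ker.
Qed.

(** [A0 + P] factors as [(1 + A1 U (1 - P))(A1 + P)], where [U] is [fa_update]; exchanging factors
    in the determinant absorbs [1 - P] into [A1]. *)
Lemma fa_Sigma0_det P : kernel_proj P A1 ->
  ln (\det (A0 + P)) = ln (\det (A1 + P)) + ln (\det Sigma) - ln (\det S).
Proof.
move=> kP; have pA1 := fa_Sigma1_psd H Q D_psd; have [PT PP AP pd] := kP.
have -> : A0 + P = (1%:M + A1 *m fa_update *m (1%:M - P)) *m (A1 + P).
  rewrite A0E !mulmxDl !mul1mx -addrA [RHS]addrAC -addrA; congr (_ + _).
  rewrite -[X in _ = X + P]mulmxA.
  rewrite [(1%:M - P) *m _]mulmxBl mul1mx (mulmxDr P) PP.
  by rewrite (kernel_proj_mull pA1 kP) add0r addrK.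
rewrite det_mulmx det_1DmulC mulmxA [(1%:M - P) *m _]mulmxBl mul1mx.
rewrite (kernel_proj_mull pA1 kP) subr0 det_update.
have d1 := pd_det_gt0 pd; have d2 := pd_det_gt0 Sigma_pd; have d3 := pd_det_gt0 S_pd.
rewrite lnM ?posrE ?divr_gt0// ln_div ?posrE//.
by rewrite addrC addrA.
Qed.

(** Passing from [Sigma_1] to [Sigma_0] keeps the conditional law of the factors given the
    observations, so the inverse covariance changes only in its first block, from which
    [S^-1 - Sigma^-1] is subtracted. *)
Definition fa_ginv0 : 'M[R]_(n + k) :=
  joint_ginv H D Q - first_block *m (invmx S - invmx Sigma) *m first_block^T.

Lemma fa_ginv0P : A0 *m fa_ginv0 *m A0 = A0.
Proof.
have G1 := joint_ginvP H uQ D_diag.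
pose C := invmx S *m Sigma *m invmx S - invmx S; pose V := invmx S - invmx Sigma.
(* The Woodbury relation between the changes of covariance and of inverse covariance. *)
have CV : C = V + C *m S *m V.
  have -> : C *m S = invmx S *m Sigma - 1%:M by rewrite mulmxBl mulVmx// mulmxKV.
  rewrite mulmxBl mul1mx /V mulmxBr mulmxK// [RHS]addrC subrK.
  by [].
pose J : 'M[R]_(n + k, n) := first_block.
have key : (1%:M + A1 *m fa_update) *m (A1 - A1 *m J *m V *m J^T *m A1) = A1.
  have UE : fa_update = J *m C *m J^T by [].
  have JAJ : J^T *m A1 *m J = S := first_fa_Sigma1_first H D Q.
  rewrite mulmxBr mulmxDl mul1mx [X in _ - X]mulmxDl mul1mx UE.
  have -> : A1 *m (J *m C *m J^T) *m (A1 *m J *m V *m J^T *m A1) =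
      A1 *m J *m (C *m (J^T *m A1 *m J) *m V) *m J^T *m A1 by rewrite !mulmxA.
  have -> : A1 *m (J *m C *m J^T) *m A1 = A1 *m J *m C *m J^T *m A1 by rewrite !mulmxA.
  rewrite JAJ -mulmxDl -mulmxDl -[X in _ - X *m J^T *m A1]mulmxDr -CV.
  by rewrite addrK.
have A0E' : A0 = A1 *m (1%:M + fa_update *m A1).
  by rewrite fa_Sigma0E mulmxDr mulmx1 mulmxA.
rewrite [X in X *m _ *m _]A0E -!mulmxA [X in _ *m (_ *m (_ *m X))]A0E'.
rewrite [fa_ginv0 *m _]mulmxA [A1 *m (_ *m _)]mulmxA mulmxA.
have -> : A1 *m (fa_ginv0 *m A1) = A1 - A1 *m J *m V *m J^T *m A1.
  rewrite mulmxBl (mulmxBr A1) (mulmxA A1 (joint_ginv H D Q)) G1; congr (_ - _).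
  by rewrite !mulmxA.
by rewrite key -A0E'.
Qed.

End divergence_decrease.

(** * The decrease of the divergence in one step *)

Section divergence_identity.
Context {R : realType} {n k : nat}.
Variables (Sigma : 'M[R]_n) (H : 'M[R]_(n, k)) (D : 'M[R]_n) (Q : 'M[R]_k).
Hypothesis Sigma_pd : pdmx Sigma.
Hypothesis D_diag : is_diag_mx D.
Hypothesis D_psd : psdmx D.
Hypothesis S_pd : pdmx (fa_cov H D).
Hypothesis uQ : Q \in unitmx.

Local Notation S := (fa_cov H D).
Local Notation H1 := (fa_H Sigma H D).
Local Notation D1 := (diagpart (fa_residual Sigma H D)).
Local Notation Q1 := (sqrtmx (fa_R Sigma H D) *m Q).
Local Notation A1 := (fa_Sigma1 H D Q).
Local Notation A0 := (fa_Sigma0 Sigma H D Q).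
Local Notation B1 := (fa_Sigma1 H1 D1 Q1).
Local Notation B0 := (fa_Sigma0 Sigma H1 D1 Q1).
Local Notation S1 := (fa_cov H1 D1).

Let D1_diag : is_diag_mx D1 := diagpart_diag _.
Let D1_psd : psdmx D1 := psd_diagpart (fa_residual_psd Sigma_pd D_psd S_pd).
Let S1_pd : pdmx S1 := fa_next_cov_pd Sigma_pd D_psd S_pd.

Lemma fa_Q_unit : Q1 \in unitmx.
Proof. by have [_ _ uB] := sqrt_fa_R Sigma_pd D_psd S_pd; rewrite unitmx_mul uB. Qed.

Lemma fa_kernel_proj P : kernel_proj P A1 ->
  [/\ kernel_proj P A0, kernel_proj P B1 & kernel_proj P B0].
Proof.
move=> kP; have pA1 := fa_Sigma1_psd H Q D_psd.
have pB1 := fa_Sigma1_psd H1 Q1 D1_psd.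
have kB1 : kernel_proj P B1.
  by apply: same_ker_proj kP => //; exact: fa_Sigma1_next_ker.
split=> //.
- apply: same_ker_proj kP => //; [exact: fa_Sigma0_psd|exact: fa_Sigma0_ker].
- apply: same_ker_proj kB1 => //; [exact: fa_Sigma0_psd|].
  by apply: fa_Sigma0_ker => //; exact: fa_Q_unit.
Qed.

(** Two Pythagorean relations added up. The log-determinants reduce to those of [S] and [S1] by
    [fa_Sigma0_det]. In the traces, [B1 - A1] and [B0 - A0] are split at [A0] and [B1] respectively,
    and the common part [B1 - A0] contributes nothing. *)
Lemma fa_divergence_identity P : kernel_proj P A1 ->
  gauss_div 0 Sigma S - gauss_div 0 Sigma S1 = gauss_div P B1 A1 + gauss_div P A0 B0.
Proof.
move=> kA1; have [kA0 kB1 kB0] := fa_kernel_proj kA1.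
have uQ1 := fa_Q_unit.
have pA1 := fa_Sigma1_psd H Q D_psd; have pB1 := fa_Sigma1_psd H1 Q1 D1_psd.
have pA0 := fa_Sigma0_psd Q Sigma_pd D_psd S_pd.
have pB0 := fa_Sigma0_psd Q1 Sigma_pd D1_psd S1_pd.
pose J : 'M[R]_(n + k, n) := first_block.
have off : B1 - A0 = J *m (S1 - Sigma) *m J^T.
  rewrite fa_Sigma0_residual// first_block_conj /fa_Sigma1 opp_block_mx add_block_mx !subrr.
  congr block_mx; rewrite /fa_cov /fa_residual.
  by rewrite [_ + (Sigma - _)]addrC subrK.
have diag0 i : (S1 - Sigma) i i = 0.
  have -> : S1 - Sigma = D1 - fa_residual Sigma H D.
    by rewrite /fa_cov [X in _ = _ - X]/fa_residual opprB addrA [D1 + _]addrC.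
  by rewrite mxE [X in _ + X]mxE diagpartE eqxx mulr1n subrr.
have tr_off (X : 'M[R]_(n, k)) D' Q' : Q' \in unitmx ->
    \tr (joint_ginv X D' Q' *m (B1 - A0)) = 0.
  move=> uQ'; move: (joint_ginv X D' Q') (joint_ginv_first X D' uQ') => g gE.
  by rewrite off mulmxA mxtrace_mulC !mulmxA gE trace_diag_off.
have tr_upd (X : 'M[R]_(n, k)) D' Q' : Q' \in unitmx -> is_diag_mx D' ->
    pdmx (fa_cov X D') -> psdmx D' ->
    \tr (joint_ginv X D' Q' *m (fa_Sigma0 Sigma X D' Q' - fa_Sigma1 X D' Q')) =
    \tr (invmx (fa_cov X D') *m (Sigma - fa_cov X D')).
  move=> uQ' dD' pS' pD'; have uS' := pd_unit pS'.
  rewrite fa_Sigma0E// addrC addKr.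
  move: (joint_ginv X D' Q') (joint_ginvP X uQ' dD') => g gE.
  rewrite mulmxA mxtrace_mulC !mulmxA gE mxtrace_mulC.
  rewrite !mulmxA first_fa_Sigma1_first mulmxBr !mulmxA mulmxV// mul1mx.
  by rewrite mulmxBr mulVmx// !raddfB /= mxtrace_mulC.
rewrite /gauss_div !addr0.
rewrite (trace_ginverse pB1 pA1 kB1 kA1 (joint_ginvP H uQ D_diag)).
rewrite (trace_ginverse pA0 pB0 kA0 kB0 (fa_ginv0P Sigma_pd D1_diag D1_psd S1_pd uQ1)).
rewrite (fa_Sigma0_det Sigma_pd D_psd S_pd kA1).
rewrite (fa_Sigma0_det Sigma_pd D1_psd S1_pd kB1).
have -> : \tr (joint_ginv H D Q *m (B1 - A1)) = \tr (invmx S *m (Sigma - S)).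
  by rewrite -(subrKA A0) mulmxDr mxtraceD tr_off// add0r tr_upd.
have -> : \tr (fa_ginv0 Sigma H1 D1 Q1 *m (A0 - B0)) = - \tr (invmx S1 *m (Sigma - S1)).
  rewrite /fa_ginv0 mulmxBl raddfB /=.
  (* The first-block correction in [fa_ginv0] contributes nothing, since [A0] and [B0] have the same
     first block [Sigma]. *)
  rewrite [X in _ - X](_ : _ = 0) ?subr0.
    rewrite -opprB mulmxN raddfN /= -(subrKA B1) mulmxDr mxtraceD.
    by rewrite tr_upd// tr_off// addr0.
  rewrite -/J -(mulmxA (J *m _)) mxtrace_mulC mulmxA.
  have -> : J^T *m (A0 - B0) *m J = 0.
    rewrite mulmxBr mulmxBl /fa_Sigma0 /J /first_block tr_col_mx trmx1 trmx0.
    by rewrite !mul_row_block !mul_row_col !mul1mx !mul0mx !mulmx1 !mulmx0 !addr0 subrr.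
  by rewrite mul0mx mxtrace0.
by field.
Qed.

End divergence_identity.

(** * Limit points *)

Section log_det.
Context {R : realType} {m : nat}.
Implicit Types A B M P : 'M[R]_m.

Definition stein_loss M : R := \tr M - m%:R - ln (\det M).

(** The inequalities [r <= exp (r - 1)] multiplied over the eigenvalues. *)
Lemma stein_loss_ge0 M : pdmx M -> 0 <= stein_loss M.
Proof.
rewrite /stein_loss; case: m M => [|n] M pM.
  by rewrite det_mx00 ln1 subr0 /mxtrace big_ord0 subr0.
have [r [ev dE tE _]] := symmetric_spectrum pM.1.
have r0 i : 0 < r i.
  have [v v0 vM] := ev i; have := pM.2 v v0.
  by rewrite -mulmxA vM -scalemxAr mxE pmulr_lgt0// dot_gt0.
rewrite subr_ge0 -ler_expR lnK ?posrE ?pd_det_gt0// dE tE.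
have -> : \sum_i r i - n.+1%:R = \sum_i (r i - 1).
  by rewrite sumrB sumr_const card_ord.
rewrite expR_sum; apply: ler_prod => i _; rewrite ltW//=.
by rewrite -[leLHS](subrKC 1) expR_ge1Dx.
Qed.

Lemma trace_sqr_sym A : A^T = A -> \tr (A *m A) = \sum_i \sum_j A i j ^+ 2.
Proof.
move=> sA; apply: eq_bigr => i _; rewrite mxE; apply: eq_bigr => j _.
by rewrite expr2 -[in X in _ * X]sA mxE.
Qed.

Lemma sqr_entry_le_trace A i j : A^T = A -> A i j ^+ 2 <= \tr (A *m A).
Proof.
move=> sA; rewrite trace_sqr_sym// (bigD1 i)//= (bigD1 j)//= -addrA lerDl.
by rewrite addr_ge0// ?sumr_ge0// => l _; rewrite ?sumr_ge0// => *; exact: sqr_ge0.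
Qed.

(** The difference of the two sides is twice the loss of [M^(1/2)]. *)
Lemma stein_loss_sqrt M : pdmx M ->
  \tr ((sqrtmx M - 1%:M) *m (sqrtmx M - 1%:M)) <= stein_loss M.
Proof.
move=> pM; have [pB BB] := sqrtmxP (pd_psd pM).
have uB : sqrtmx M \in unitmx.
  by have := pd_unit pM; rewrite -{1}BB unitmx_mul => /andP[].
have pdB := psd_unit_pd pB uB; have dB := pd_det_gt0 pdB.
have := stein_loss_ge0 pdB; rewrite /stein_loss.
have -> : ln (\det M) = 2 * ln (\det (sqrtmx M)).
  by rewrite -{1}BB det_mulmx -expr2 lnXn// mulr_natl.
have -> : (sqrtmx M - 1%:M) *m (sqrtmx M - 1%:M) = M - sqrtmx M - sqrtmx M + 1%:M.
  by rewrite mulmxBr !mulmxBl BB !mulmx1 !mul1mx opprB addrA addrAC.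
rewrite !(raddfB, raddfD) /= mxtrace1; lra.
Qed.

(** For an eigenvalue [s^2] this is [s^2 <= 2 (s - 1)^2 + 2], that is, [(s - 2)^2 >= 0], combined
    with the previous bound. *)
Lemma trace_le_stein_loss M : pdmx M -> \tr M <= 2 * stein_loss M + 2 * m%:R.
Proof.
move=> pM; have [pB BB] := sqrtmxP (pd_psd pM).
have := stein_loss_sqrt pM.
have s2 : (sqrtmx M - 2%:M)^T = sqrtmx M - 2%:M by rewrite linearB/= tr_scalar_mx pB.1.
have : 0 <= \tr ((sqrtmx M - 2%:M) *m (sqrtmx M - 2%:M)).
  by rewrite trace_sqr_sym// sumr_ge0// => i _; rewrite sumr_ge0// => j _; rewrite sqr_ge0.
rewrite !mulmxBr !mulmxBl BB !mulmx1 !mul1mx !mul_mx_scalar !mul_scalar_mx.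
rewrite !raddfB /= !mxtraceZ !mxtrace_scalar -[2 *+ m]mulr_natr; lra.
Qed.

(** The covariance [A + P] in coordinates where [B + P] is the identity; the divergence becomes a
    function of this single matrix. *)
Definition whiten P A B : 'M[R]_m :=
  invmx (sqrtmx (B + P)) *m (A + P) *m invmx (sqrtmx (B + P)).

Lemma whitenP P A B : pdmx (A + P) -> pdmx (B + P) ->
  [/\ pdmx (whiten P A B), gauss_div P A B = stein_loss (whiten P A B) / 2 &
      A - B = sqrtmx (B + P) *m (whiten P A B - 1%:M) *m sqrtmx (B + P)].
Proof.
move=> pA pB; have [pS SS] := sqrtmxP (pd_psd pB).
set S := sqrtmx (B + P) in pS SS *.
have uS : S \in unitmx by have := pd_unit pB; rewrite -SS unitmx_mul => /andP[].
have pW : pdmx (whiten P A B).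
  rewrite /whiten -/S -{1}[invmx S]trmxK trmx_inv pS.1 -{1}pS.1 -trmx_inv trmxK.
  rewrite -{1}pS.1 -trmx_inv; apply: pd_congr => // x Sx.
  by rewrite -[x](mulKVmx uS) Sx mulmx0.
split=> //.
- have dS : 0 < \det (B + P) := pd_det_gt0 pB.
  have dA : 0 < \det (A + P) := pd_det_gt0 pA.
  rewrite /gauss_div /stein_loss; congr (_ / 2).
  have -> : \det (whiten P A B) = \det (A + P) / \det (B + P).
    by rewrite /whiten -/S !det_mulmx !det_inv -SS det_mulmx invfM mulrCA mulrA.
  have -> : \tr (whiten P A B) = \tr (invmx (B + P) *m (A + P)).
    by rewrite /whiten -/S mxtrace_mulC mulmxA -invmxM// SS.
  have -> : A - B = (A + P) - (B + P) by rewrite opprD addrACA subrr addr0.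
  rewrite mulmxBr mulVmx ?pd_unit// raddfB /= mxtrace1 ln_div ?posrE//; lra.
- rewrite mulmxBr mulmxBl mulmx1 SS /whiten -/S !mulmxA mulmxV// mul1mx mulmxKV//.
  by rewrite opprD addrACA subrr addr0.
Qed.

Lemma gauss_div_ge0 P A B : pdmx (A + P) -> pdmx (B + P) -> 0 <= gauss_div P A B.
Proof. by move=> pA /(whitenP pA)[pW -> _]; rewrite divr_ge0// stein_loss_ge0. Qed.

End log_det.

(** * Limits and bounds of matrix sequences *)

Section entrywise_convergence.
Context {R : realType}.

Definition mxcvg p q (X : nat -> 'M[R]_(p, q)) (L : 'M[R]_(p, q)) :=
  forall i j, X t i j @[t --> \oo] --> L i j.

Definition mxbounded p q (X : nat -> 'M[R]_(p, q)) :=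
  exists c : R, forall t i j, `|X t i j| <= c.

Lemma mxcvg_cst p q (L : 'M[R]_(p, q)) : mxcvg (fun=> L) L.
Proof. by move=> i j; exact: cvg_cst. Qed.
Arguments mxcvg_cst {p q} L.

Lemma mxcvgD p q (X Y : nat -> 'M[R]_(p, q)) L L' :
  mxcvg X L -> mxcvg Y L' -> mxcvg (fun t => X t + Y t) (L + L').
Proof.
move=> XL YL i j; rewrite mxE; under eq_fun do rewrite mxE.
by apply: cvgD; [exact: XL|exact: YL].
Qed.

Lemma mxcvgN p q (X : nat -> 'M[R]_(p, q)) L : mxcvg X L -> mxcvg (fun t => - X t) (- L).
Proof. by move=> XL i j; rewrite mxE; under eq_fun do rewrite mxE; apply: cvgN; exact: XL. Qed.

Lemma mxcvgB p q (X Y : nat -> 'M[R]_(p, q)) L L' :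
  mxcvg X L -> mxcvg Y L' -> mxcvg (fun t => X t - Y t) (L - L').
Proof. by move=> XL YL; apply: mxcvgD => //; exact: mxcvgN. Qed.

Lemma mxcvgT p q (X : nat -> 'M[R]_(p, q)) L : mxcvg X L -> mxcvg (fun t => (X t)^T) L^T.
Proof. by move=> XL i j; rewrite mxE; under eq_fun do rewrite mxE; exact: XL. Qed.

Lemma mxcvgM p q r (X : nat -> 'M[R]_(p, q)) (Y : nat -> 'M[R]_(q, r)) L L' :
  mxcvg X L -> mxcvg Y L' -> mxcvg (fun t => X t *m Y t) (L *m L').
Proof.
move=> XL YL i j; rewrite mxE; under eq_fun do rewrite mxE.
apply: cvg_big => [|l _]; first exact: add_continuous.
by apply: cvgM; [exact: XL|exact: YL].
Qed.

Lemma mxcvg_diagpart p (X : nat -> 'M[R]_p) L :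
  mxcvg X L -> mxcvg (fun t => diagpart (X t)) (diagpart L).
Proof.
move=> XL i j; rewrite diagpartE; under eq_fun do rewrite diagpartE.
by case: (i == j); [exact: XL|exact: cvg_cst].
Qed.

Lemma mxcvg_unique p q (X : nat -> 'M[R]_(p, q)) L L' : mxcvg X L -> mxcvg X L' -> L = L'.
Proof.
move=> XL XL'; apply/matrixP => i j.
by apply: (cvg_unique _ (XL i j) (XL' i j)).
Qed.

Lemma mxcvg_sub p q (X : nat -> 'M[R]_(p, q)) L (s : nat -> nat) :
  (forall j, (j <= s j)%N) -> mxcvg X L -> mxcvg (X \o s) L.
Proof.
move=> sj XL i j; apply: (cvg_comp s (fun t => X t i j)); last exact: XL.
by apply/cvgnyPge => N; near=> t; apply: leq_trans (sj t); near: t; exact: nbhs_infty_ge.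
Unshelve. all: by end_near. Qed.

Lemma mxboundedM p q r (X : nat -> 'M[R]_(p, q)) (Y : nat -> 'M[R]_(q, r)) :
  mxbounded X -> mxbounded Y -> mxbounded (fun t => X t *m Y t).
Proof.
move=> [c Xc] [d Yd]; exists (\sum_(l < q) c * d) => t i j.
rewrite mxE; apply: le_trans (ler_norm_sum _ _ _) _; apply: ler_sum => l _.
by rewrite normrM ler_pM.
Qed.

Lemma mxbounded_cst p q (L : 'M[R]_(p, q)) : mxbounded (fun=> L).
Proof.
exists (\sum_i \sum_j `|L i j|) => _ i j.
rewrite (bigD1 i)//= (bigD1 j)//= -addrA lerDl addr_ge0// sumr_ge0// => l _.
by rewrite sumr_ge0.
Qed.

Lemma mxcvg0_boundedl p q r (X : nat -> 'M[R]_(p, q)) (Y : nat -> 'M[R]_(q, r)) :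
  mxbounded X -> mxcvg Y 0 -> mxcvg (fun t => X t *m Y t) 0.
Proof.
move=> [c Xc] Y0 i j; rewrite mxE; under eq_fun do rewrite mxE.
suff H : \sum_(l < q) X t i l * Y t l j @[t --> \oo] --> \sum_(l < q) (0 : R).
  by rewrite big1 in H.
apply: cvg_big => [|l _]; first exact: add_continuous.
have c0 : 0 <= c by apply: le_trans (Xc 0%N i l).
apply: norm_cvg0; apply: (@squeeze_cvgr _ _ _ _ (fun=> 0) (fun t => c * `|Y t l j|)).
- by near=> t; rewrite normr_ge0/= normrM ler_wpM2r.
- exact: cvg_cst.
- have H : c * `|Y t l j| @[t --> \oo] --> c * 0.
    by apply: cvgMr; apply/norm_cvg0P; have := Y0 l j; rewrite mxE.
  by rewrite mulr0 in H.
Unshelve. all: by end_near. Qed.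

Lemma mxcvg0_boundedr p q r (X : nat -> 'M[R]_(p, q)) (Y : nat -> 'M[R]_(q, r)) :
  mxcvg X 0 -> mxbounded Y -> mxcvg (fun t => X t *m Y t) 0.
Proof.
move=> X0 [c Yc]; have YT : mxbounded (fun t => (Y t)^T).
  by exists c => t i j; rewrite mxE.
have X0T : mxcvg (fun t => (X t)^T) 0 by rewrite -trmx0; exact: mxcvgT.
have := mxcvgT (mxcvg0_boundedl YT X0T); rewrite trmx0.
by under eq_fun do rewrite trmx_mul !trmxK.
Qed.

Lemma trace_sqr_bounded p (X : nat -> 'M[R]_p) c : (forall t, (X t)^T = X t) ->
  (forall t, \tr (X t *m X t) <= c) -> mxbounded X.
Proof.
move=> sX Xc; exists (1 + c) => t i j.
have := le_trans (sqr_entry_le_trace i j (sX t)) (Xc t).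
rewrite -real_normK ?num_real//; have := normr_ge0 (X t i j); nra.
Qed.

(** The trace is the sum of the squared entries of the root, so the root is bounded, and with it its
    square. *)
Lemma trace_bounded p (X : nat -> 'M[R]_p) c : (forall t, psdmx (X t)) ->
  (forall t, \tr (X t) <= c) -> mxbounded X.
Proof.
move=> pX Xc; have bS : mxbounded (fun t => sqrtmx (X t)).
  apply: (@trace_sqr_bounded _ _ c) => t; have [[sS _] SS] := sqrtmxP (pX t) => //.
  by rewrite SS.
have := mxboundedM bS bS.
by under eq_fun do rewrite (sqrtmxP (pX _)).2.
Qed.

Lemma trace_sqr_cvg0 p (X : nat -> 'M[R]_p) : (forall t, (X t)^T = X t) ->
  \tr (X t *m X t) @[t --> \oo] --> 0 -> mxcvg X 0.
Proof.
move=> sX X0 i j; rewrite mxE; apply/cvgr0Pnorm_lt => e e0.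
have e2 : 0 < e ^+ 2 by rewrite exprn_gt0.
move/cvgr0Pnorm_lt : X0 => /(_ _ e2); apply: filterS => t.
rewrite ger0_norm; last exact: le_trans (sqr_ge0 _) (sqr_entry_le_trace i j (sX t)).
move=> /(le_lt_trans (sqr_entry_le_trace i j (sX t))).
by rewrite -real_normK ?num_real// ltr_pXn2r ?nnegrE// ltW.
Qed.

(** [C = X^(1/2) - 1] tends to 0 by [stein_loss_sqrt], and [X - 1 = C^2 + 2 C]. *)
Lemma stein_loss_cvg0 p (X : nat -> 'M[R]_p) : (forall t, pdmx (X t)) ->
  stein_loss (X t) @[t --> \oo] --> 0 -> mxcvg (fun t => X t - 1%:M) 0.
Proof.
move=> pX X0; pose C t := sqrtmx (X t) - 1%:M.
have sC t : (C t)^T = C t.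
  by rewrite linearB/= trmx1 (sqrtmxP (pd_psd (pX t))).1.1.
have C0 : mxcvg C 0.
  apply: trace_sqr_cvg0 => //.
  apply: (@squeeze_cvgr _ _ _ _ (fun=> 0) (fun t => stein_loss (X t))) => //;
    last exact: cvg_cst.
  near=> t; rewrite stein_loss_sqrt// andbT trace_sqr_sym//.
  by rewrite sumr_ge0// => i _; rewrite sumr_ge0// => j _; rewrite sqr_ge0.
have E t : X t - 1%:M = C t *m C t + (C t + C t).
  rewrite -{1}(sqrtmxP (pd_psd (pX t))).2 -(subrK 1%:M (sqrtmx (X t))) -/(C t).
  move: (C t) => Z; rewrite mulmxDl !mulmxDr mul1mx !mulmx1 addrA addrK -addrA//.
under eq_fun do rewrite E.
have : mxcvg (fun t => C t *m C t + (C t + C t)) ((0 : 'M[R]_p) *m 0 + (0 + 0)).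
  by apply: mxcvgD; [exact: mxcvgM|exact: mxcvgD].
by rewrite mulmx0 !addr0.
Unshelve. all: by end_near. Qed.

(** The whitened matrix tends to 1, and [A - B] is its deviation from 1 between two roots of
    [B + P], which are bounded. [P] may vary with [t]. *)
Lemma gauss_div_cvg0 p (P A B : nat -> 'M[R]_p) c :
  (forall t, psdmx (B t)) -> (forall t, \tr (B t) <= c) ->
  (forall t, kernel_proj (P t) (A t)) -> (forall t, kernel_proj (P t) (B t)) ->
  gauss_div (P t) (A t) (B t) @[t --> \oo] --> 0 -> mxcvg (fun t => A t - B t) 0.
Proof.
move=> pB Bc kA kB AB0.
have pAP t : pdmx (A t + P t) by case: (kA t).
have pBP t : pdmx (B t + P t) by case: (kB t).
(* A symmetric idempotent has [P_ii^2 <= P_ii], hence [P_ii <= 1]. *)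
have trP t : \tr (P t) <= p%:R.
  have [PT PP _ _] := kA t.
  have -> : p%:R = \sum_(i < p) (1 : R) by rewrite sumr_const card_ord.
  apply: ler_sum => i _; have : (P t i i) ^+ 2 <= P t i i.
    rewrite -[in leRHS]PP mxE (bigD1 i)//= -expr2 lerDl sumr_ge0// => j _.
    by rewrite -{2}PT mxE -expr2 sqr_ge0.
  by nra.
have bS : mxbounded (fun t => sqrtmx (B t + P t)).
  apply: (@trace_sqr_bounded _ _ (c + p%:R)) => t;
    have [[sS _] SS] := sqrtmxP (pd_psd (pBP t)) => //.
  by rewrite SS mxtraceD lerD.
pose W t := whiten (P t) (A t) (B t).
have W0 : mxcvg (fun t => W t - 1%:M) 0.
  apply: stein_loss_cvg0 => [t|]; first by case: (whitenP (pAP t) (pBP t)).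
  have -> : (fun t => stein_loss (W t)) = fun t => 2 * gauss_div (P t) (A t) (B t).
    apply/funext => t; have [_ -> _] := whitenP (pAP t) (pBP t).
    by rewrite mulrC divfK.
  have H : 2 * gauss_div (P t) (A t) (B t) @[t --> \oo] --> (2 * 0 : R) by apply: cvgMr.
  by rewrite mulr0 in H.
have E t : A t - B t = sqrtmx (B t + P t) *m (W t - 1%:M) *m sqrtmx (B t + P t).
  by have [_ _] := whitenP (pAP t) (pBP t).
under eq_fun do rewrite E.
by apply: mxcvg0_boundedr => //; exact: mxcvg0_boundedl.
Qed.

(** An index [t >= N] within [1/(N+1)] of the limit is chosen for each [N]. The map [s] need not be
    increasing: [j <= s j] is enough for limits to pass to it. *)
Lemma cluster_subsequence p q p' q'
    (X : nat -> 'M[R]_(p, q)) (Y : nat -> 'M[R]_(p', q')) L L' :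
  cluster ((fun t => (X t, Y t)) @ \oo) (L, L') ->
  exists s : nat -> nat, [/\ forall j, (j <= s j)%N, mxcvg (X \o s) L & mxcvg (Y \o s) L'].
Proof.
move=> cl.
have pick (N : nat) : exists t, [/\ (N <= t)%N,
    forall i j, `|L i j - X t i j| < N.+1%:R^-1 &
    forall i j, `|L' i j - Y t i j| < N.+1%:R^-1].
  have e0 : 0 < N.+1%:R^-1 :> R by rewrite invr_gt0.
  pose U := [set u : 'M[R]_(p, q) * 'M[R]_(p', q') | exists2 t, (N <= t)%N & u = (X t, Y t)].
  have FU : ((fun t => (X t, Y t)) @ \oo) U by exists N => // t Nt; exists t.
  have [_ [[t Nt ->] [/= [_ BX] [_ BY]]]] := cl _ _ FU (nbhsx_ballx (L, L') _ e0).
  by exists t; split.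
have [s sP] := choice pick; exists s.
have cv (u : nat -> R) l : (forall N, `|l - u N| < N.+1%:R^-1) -> u @ \oo --> l.
  move=> ul; apply/cvgrPdist_lt => e e0; near=> N.
  apply: lt_trans (ul N) _; near: N; exact: near_infty_natSinv_lt (PosNum e0).
split=> [j|i j|i j]; first by case: (sP j).
- by apply: cv => N; case: (sP N).
- by apply: cv => N; case: (sP N).
Unshelve. all: by end_near. Qed.

End entrywise_convergence.
Arguments mxcvg_cst {R p q} L.

Lemma pd_kernel_proj {R : realType} {m : nat} (A : 'M[R]_m) :
  pdmx A -> kernel_proj 0 A.
Proof. by move=> pA; split; rewrite ?trmx0 ?mulmx0 ?addr0. Qed.

Lemma idiv_pd {R : realType} {m : nat} (A B : 'M[R]_m) : pdmx A -> pdmx B ->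
  idiv A B = (gauss_div 0 A B)%:E.
Proof. by move=> pA pB; apply: gaussian_idiv; do ?exact: pd_psd; exact: pd_kernel_proj. Qed.

(** * The sequence generated by the algorithm *)

Section algorithm.
Context {R : realType} {n k : nat}.
Variables (Sigma : 'M[R]_n) (H : nat -> 'M[R]_(n, k)) (D : nat -> 'M[R]_n).
Hypothesis Sigma_pd : pdmx Sigma.
Hypothesis D0_diag : is_diag_mx (D 0%N).
Hypothesis D0_psd : psdmx (D 0%N).
Hypothesis cov0_unit : H 0%N *m (H 0%N)^T + D 0%N \in unitmx.
Hypothesis HD : fa_algorithm Sigma H D.

Local Notation S t := (fa_cov (H t) (D t)).

Lemma fa_HS t : H t.+1 = fa_H Sigma (H t) (D t).
Proof. by case: (HD t). Qed.

Lemma fa_DS t : D t.+1 = diagpart (fa_residual Sigma (H t) (D t)).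
Proof. by case: (HD t) => _ ->; rewrite fa_HS. Qed.

Lemma fa_invariant t : [/\ is_diag_mx (D t), psdmx (D t) & pdmx (S t)].
Proof.
elim: t => [|t [dD pD pS]].
  split=> //; apply: psd_unit_pd => //; apply: psd_add => //.
  by rewrite -{1}[H 0%N]trmxK; exact: gram_psd.
rewrite fa_DS fa_HS; split; first exact: diagpart_diag.
- exact/psd_diagpart/fa_residual_psd.
- exact: fa_next_cov_pd.
Qed.

Let dD t : is_diag_mx (D t). Proof. by case: (fa_invariant t). Qed.
Let pD t : psdmx (D t). Proof. by case: (fa_invariant t). Qed.
Let pS t : pdmx (S t). Proof. by case: (fa_invariant t). Qed.
Let uS t : S t \in unitmx. Proof. exact: pd_unit. Qed.

Let pHH t : psdmx (H t *m (H t)^T).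
Proof. by rewrite -{1}[H t]trmxK; exact: gram_psd. Qed.

Let trace_ge0 m (A : 'M[R]_m) : psdmx A -> 0 <= \tr A.
Proof. by move=> pA; apply: sumr_ge0 => i _; exact: psd_diag_ge0. Qed.

(** From [t = 1] on, [D_t] completes the diagonal of [H_t H_t^T] to that of [Sigma]; the second term
    covers [t = 0]. *)
Let trace_cov t : \tr (S t) <= \tr Sigma + \tr (S 0%N).
Proof.
case: t => [|t]; first by rewrite lerDr; exact/trace_ge0/pd_psd.
have -> : \tr (S t.+1) = \tr Sigma; last by rewrite lerDl; exact/trace_ge0/pd_psd.
rewrite /fa_cov (HD t).2 mxtraceD.
have -> (A : 'M[R]_n) : \tr (diagpart A) = \tr A.
  by apply: eq_bigr => i _; rewrite diagpartE eqxx.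
by rewrite raddfB /= addrC subrK.
Qed.

Let f t := gauss_div 0 Sigma (S t).

Let f_ge0 t : 0 <= f t.
Proof. by apply: gauss_div_ge0; rewrite addr0. Qed.

Lemma fa_idiv_identity (Q : nat -> 'M[R]_k) t : Q t \in unitmx ->
  Q t.+1 = sqrtmx (fa_R Sigma (H t) (D t)) *m Q t ->
  exists P, [/\ kernel_proj P (fa_Sigma1 (H t.+1) (D t.+1) (Q t.+1)),
    kernel_proj P (fa_Sigma1 (H t) (D t) (Q t)),
    kernel_proj P (fa_Sigma0 Sigma (H t) (D t) (Q t)),
    kernel_proj P (fa_Sigma0 Sigma (H t.+1) (D t.+1) (Q t.+1)) &
    f t - f t.+1 =
      gauss_div P (fa_Sigma1 (H t.+1) (D t.+1) (Q t.+1)) (fa_Sigma1 (H t) (D t) (Q t)) +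
      gauss_div P (fa_Sigma0 Sigma (H t) (D t) (Q t))
                  (fa_Sigma0 Sigma (H t.+1) (D t.+1) (Q t.+1))].
Proof.
move=> uQ QS.
have [P kP] := exists_kernel_proj (fa_Sigma1_psd (H t) (Q t) (pD t)).
have [k1 k2 k3] := fa_kernel_proj Sigma_pd (dD t) (pD t) (pS t) uQ kP.
exists P; rewrite /f QS fa_HS fa_DS; split=> //.
exact: fa_divergence_identity.
Qed.

Lemma fa_idiv_step (Q : nat -> 'M[R]_k) t : Q t \in unitmx ->
  Q t.+1 = sqrtmx (fa_R Sigma (H t) (D t)) *m Q t ->
  (idiv Sigma (S t) - idiv Sigma (S t.+1)
   = idiv (fa_Sigma1 (H t.+1) (D t.+1) (Q t.+1)) (fa_Sigma1 (H t) (D t) (Q t))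
   + idiv (fa_Sigma0 Sigma (H t) (D t) (Q t))
          (fa_Sigma0 Sigma (H t.+1) (D t.+1) (Q t.+1)))%E.
Proof.
move=> uQ QS; have [P [k1 k2 k3 k4 E]] := fa_idiv_identity uQ QS.
rewrite (idiv_pd Sigma_pd (pS t)) (idiv_pd Sigma_pd (pS t.+1)).
rewrite (gaussian_idiv _ _ k1 k2) ?(gaussian_idiv _ _ k3 k4).
- by rewrite -EFinB -EFinD -E.
- exact: fa_Sigma0_psd.
- exact: fa_Sigma0_psd.
- exact: fa_Sigma1_psd.
- exact: fa_Sigma1_psd.
Qed.

Let one_step_div t : exists P, [/\
  kernel_proj P (fa_Sigma1 (H t.+1) (D t.+1) (sqrtmx (fa_R Sigma (H t) (D t)))),
  kernel_proj P (fa_Sigma1 (H t) (D t) 1%:M) &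
  0 <= gauss_div P (fa_Sigma1 (H t.+1) (D t.+1) (sqrtmx (fa_R Sigma (H t) (D t))))
                   (fa_Sigma1 (H t) (D t) 1%:M) <= f t - f t.+1].
Proof.
(* Only the values at [t] and [t + 1] matter: the one-step identity is restarted from the identity
   matrix. *)
pose Q (s : nat) := if s == t then 1%:M else sqrtmx (fa_R Sigma (H t) (D t)).
have Qt : Q t = 1%:M by rewrite /Q eqxx.
have QS : Q t.+1 = sqrtmx (fa_R Sigma (H t) (D t)) by rewrite /Q gtn_eqF.
have [||P] := @fa_idiv_identity Q t.
- by rewrite Qt unitmx1.
- by rewrite QS Qt mulmx1.
rewrite QS Qt => -[k1 k2 k3 k4 ->]; exists P; split=> //.
have [_ _ _ p1] := k1; have [_ _ _ p2] := k2; have [_ _ _ p3] := k3; have [_ _ _ p4] := k4.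
by rewrite gauss_div_ge0//= lerDl gauss_div_ge0.
Qed.

Let f_nincr : nonincreasing_seq f.
Proof.
apply/nonincreasing_seqP => t.
by have [P [_ _ /andP[/le_trans H1 /H1]]] := one_step_div t; rewrite subr_ge0.
Qed.

Let f_diff_cvg0 : f t - f t.+1 @[t --> \oo] --> 0.
Proof.
have cf : f @ \oo --> inf (range f).
  apply: nonincreasing_cvgn => //; exists 0 => _ [t _ <-]; exact: f_ge0.
rewrite -(subrr (inf (range f))); apply: cvgB => //.
by rewrite (cvg_shiftS f).
Qed.

(** The gap is the upper right block of the difference of joint covariances, because
    [H_t+1 R_t^(1/2) = Sigma S_t^-1 H_t]. *)
Lemma fa_gap_cvg0 : mxcvg (fun t => Sigma *m invmx (S t) *m H t - H t) 0.
Proof.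
have [P PP] := choice one_step_div.
have g0 : gauss_div (P t) (fa_Sigma1 (H t.+1) (D t.+1) (sqrtmx (fa_R Sigma (H t) (D t))))
    (fa_Sigma1 (H t) (D t) 1%:M) @[t --> \oo] --> 0.
  apply: (@squeeze_cvgr _ _ _ _ (fun=> 0) (fun t => f t - f t.+1)).
  - by near=> t; case: (PP t).
  - exact: cvg_cst.
  - exact: f_diff_cvg0.
have C : mxcvg (fun t => fa_Sigma1 (H t.+1) (D t.+1) (sqrtmx (fa_R Sigma (H t) (D t)))
    - fa_Sigma1 (H t) (D t) 1%:M) 0.
  apply: (@gauss_div_cvg0 _ _ P _ _ (\tr Sigma + \tr (S 0%N) + k%:R)).
  - by move=> t; exact: fa_Sigma1_psd.
  - move=> t; rewrite mxtrace_block trmx1 mulmx1 mxtrace1 lerD2r.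
    exact: trace_cov.
  - by move=> t; case: (PP t).
  - by move=> t; case: (PP t).
  - exact: g0.
have E t : Sigma *m invmx (S t) *m H t - H t =
    ursubmx (fa_Sigma1 (H t.+1) (D t.+1) (sqrtmx (fa_R Sigma (H t) (D t)))
    - fa_Sigma1 (H t) (D t) 1%:M).
  rewrite opp_block_mx add_block_mx block_mxKur mulmx1 fa_HS /fa_H mulmxKV//.
  by have [] := sqrt_fa_R Sigma_pd (pD t) (pS t).
move=> i j; under eq_fun do rewrite E ursubmxEsub mxE.
have := C (lshift k i) (rshift n j).
by rewrite !mxE.
Unshelve. all: by end_near. Qed.

Let cov_bounded : mxbounded (fun t => S t).
Proof. by apply: (trace_bounded (c := \tr Sigma + \tr (S 0%N))) => // t; exact: pd_psd. Qed.

Let H_bounded : mxbounded H.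
Proof.
exists (1 + (\tr Sigma + \tr (S 0%N))) => t i j.
have Hij : H t i j ^+ 2 <= \tr Sigma + \tr (S 0%N).
  apply: le_trans (trace_cov t); rewrite mxtraceD.
  apply: (@le_trans _ _ (\tr (H t *m (H t)^T))); last by rewrite lerDl; exact: trace_ge0.
  rewrite /mxtrace (bigD1 i)//= [X in _ <= X + _]mxE (bigD1 j)//= mxE -expr2 -addrA lerDl.
  rewrite addr_ge0// sumr_ge0// => l _; first by rewrite mxE -expr2 sqr_ge0.
  exact: psd_diag_ge0.
move: Hij; rewrite -real_normK ?num_real//; have := normr_ge0 (H t i j); nra.
Qed.

Let invcov_bounded : mxbounded (fun t => invmx (S t)).
Proof.
pose s := sqrtmx Sigma.
have [[sS _] ss] := sqrtmxP (pd_psd Sigma_pd); rewrite -/s in sS ss.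
have us : s \in unitmx by have := pd_unit Sigma_pd; rewrite -ss unitmx_mul => /andP[].
pose N t := s *m invmx (S t) *m s.
have bN : mxbounded N.
  (* [N t] has the trace of the whitened [Sigma], whose Stein loss is [2 f t <= 2 f 0];
     [trace_le_stein_loss] yields the constant. *)
  apply: (@trace_bounded _ _ _ (4 * f 0%N + 2 * n%:R)) => t.
    by rewrite /N -{1}sS; apply: psd_congr; exact/pd_psd/pd_inv.
  have p1 : pdmx (Sigma + 0) by rewrite addr0.
  have p2 : pdmx (S t + 0) by rewrite addr0.
  have [pW fE _] := whitenP p1 p2.
  have -> : \tr (N t) = \tr (whiten 0 Sigma (S t)).
    have [_ SS] := sqrtmxP (pd_psd p2).
    have uq : sqrtmx (S t + 0) \in unitmx.
      by have := pd_unit p2; rewrite -{1}SS unitmx_mul => /andP[].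
    rewrite /N mxtrace_mulC mulmxA ss mxtrace_mulC /whiten [RHS]mxtrace_mulC mulmxA.
    by rewrite -invmxM// SS !addr0.
  apply: le_trans (trace_le_stein_loss pW) _; rewrite lerD2r.
  have f0 : f t <= f 0%N by exact: f_nincr.
  rewrite /f fE in f0; rewrite /f in f0 *; lra.
have E t : invmx (S t) = invmx s *m N t *m invmx s.
  by rewrite /N !mulmxA mulVmx// mul1mx mulmxK.
under eq_fun do rewrite E.
by do 2?[apply: mxboundedM; try exact: mxbounded_cst].
Qed.

(** The previous gap multiplied by the bounded [S_t Sigma^-1], which removes the inverse of [S_t];
    only sums and products remain when passing to the limit. *)
Let gap_cvg0 : mxcvg (fun t => H t - S t *m invmx Sigma *m H t) 0.
Proof.
have E t : H t - S t *m invmx Sigma *m H t =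
    S t *m invmx Sigma *m (Sigma *m invmx (S t) *m H t - H t).
  by rewrite mulmxBr !mulmxA mulmxKV ?pd_unit// mulmxV// mul1mx.
under eq_fun do rewrite E.
by apply: mxcvg0_boundedl fa_gap_cvg0; apply: mxboundedM => //; exact: mxbounded_cst.
Qed.

(** If [L x = 0], then [S x] tends to 0 along the subsequence; the bounded inverses bring this back
    to [x = 0]. *)
Let limit_cov_unit (s : nat -> nat) L : mxcvg (fun j => S (s j)) L -> L \in unitmx.
Proof.
move=> SL; apply: inj_unitmx => x Lx.
have C : mxcvg (fun j => S (s j) *m x) 0.
  by rewrite -Lx; apply: mxcvgM => //; exact: mxcvg_cst.
have [c Sc] := invcov_bounded.
have B : mxbounded (fun j => invmx (S (s j))) by exists c => j; exact: Sc.
have := mxcvg0_boundedl B C; under eq_fun do rewrite mulKmx//.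
by move=> X0; apply: mxcvg_unique X0; exact: mxcvg_cst.
Qed.

Lemma fa_limit_gram (HH' D' : 'M[R]_n) :
  cluster ((fun t => (H t *m (H t)^T, D t)) @ \oo) (HH', D') ->
  [/\ HH' + D' \in unitmx, HH' = Sigma *m invmx (HH' + D') *m HH' &
      D' = diagpart (Sigma - HH')].
Proof.
move=> /cluster_subsequence[s [sj sH sD]].
have cS : mxcvg (fun j => S (s j)) (HH' + D') := mxcvgD sH sD.
have uL := limit_cov_unit cS; split=> //.
(* Multiplication by [H_t^T] expresses the gap through [H_t H_t^T], the quantity that converges
   here. *)
- have g1 : mxcvg (fun t => (H t - S t *m invmx Sigma *m H t) *m (H t)^T) 0.
    apply: mxcvg0_boundedr gap_cvg0 _.
    by have [c Hc] := H_bounded; exists c => t i j; rewrite mxE.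
  have g2 := mxcvgB sH (mxcvgM (mxcvgM cS (mxcvg_cst (invmx Sigma))) sH).
  have : HH' - (HH' + D') *m invmx Sigma *m HH' = 0.
    apply: mxcvg_unique g2 _; have := mxcvg_sub sj g1.
    by under eq_fun do rewrite /= mulmxBl -[_ *m H _ *m _]mulmxA.
  move=> /eqP; rewrite subr_eq0 => /eqP HE.
  by rewrite {3}HE !mulmxA mulmxKV// mulmxV ?pd_unit// mul1mx.
(* The relation [D_t = diagpart (Sigma - H_t H_t^T)] holds only from [t = 1] on; the shift ensures
   [s j.+1 >= 1]. *)
- have sj1 j : (j <= j.+1)%N by [].
  apply: mxcvg_unique (mxcvg_sub sj1 sD) _.
  have := mxcvg_diagpart (mxcvgB (mxcvg_cst Sigma) (mxcvg_sub sj1 sH)).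
  suff E j : diagpart (Sigma - H (s j.+1) *m (H (s j.+1))^T) = D (s j.+1).
    by under eq_fun do rewrite /= E.
  by have := sj j.+1; case: (s j.+1) => // t _; rewrite (HD t).2.
Qed.

Lemma fa_limit_solution (H' : 'M[R]_(n, k)) (D' : 'M[R]_n) :
  cluster ((fun t => (H t, D t)) @ \oo) (H', D') -> pdmx D' -> fa_solution Sigma H' D'.
Proof.
move=> /cluster_subsequence[s [sj sH sD]] pD'.
have sHH := mxcvgM sH (mxcvgT sH).
have cS : mxcvg (fun j => S (s j)) (H' *m H'^T + D') := mxcvgD sHH sD.
have uL := limit_cov_unit cS; have uD := pd_unit pD'; split=> //.
- have g2 := mxcvgB sH (mxcvgM (mxcvgM cS (mxcvg_cst (invmx Sigma))) sH).
  have : H' - (H' *m H'^T + D') *m invmx Sigma *m H' = 0.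
    exact: mxcvg_unique g2 (mxcvg_sub sj gap_cvg0).
  move=> /eqP; rewrite subr_eq0 => /eqP HE.
  have E : Sigma *m invmx D' *m H' = H' + H' *m H'^T *m invmx D' *m H'.
    (* A Woodbury computation: the limit equation makes [1 - W] the inverse of [1 + V] and gives
       [Sigma D'^-1 H' (1 - W) = H'], so [Sigma D'^-1 H' = H' (1 + V)]. *)
    pose Z := invmx Sigma *m H'; pose W := H'^T *m Z; pose V := H'^T *m (invmx D' *m H').
    have ZE : H' = H' *m W + D' *m Z.
      by rewrite {1}HE -(mulmxA _ (invmx Sigma)) -/Z mulmxDl -(mulmxA H' _ Z).
    have DH : invmx D' *m H' = invmx D' *m H' *m W + Z.
      by rewrite {1}ZE mulmxDr mulmxA mulKmx.
    have VW : (1%:M + V) *m (1%:M - W) = 1%:M.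
      have VE : V = V *m W + W by rewrite {1}/V DH mulmxDr mulmxA.
      by rewrite mulmxDl mul1mx mulmxBr mulmx1 {1}VE [_ *m _ + _]addrC addrK subrK.
    have XW : Sigma *m invmx D' *m H' *m (1%:M - W) = H'.
      rewrite mulmxBr mulmx1 -!(mulmxA Sigma) {1}DH mulmxDr addrC addKr.
      by rewrite mulKVmx// pd_unit.
    have -> : H' + H' *m H'^T *m invmx D' *m H' = H' *m (1%:M + V).
      by rewrite mulmxDr mulmx1 !mulmxA.
    by rewrite -{2}XW -[RHS]mulmxA (mulmx1C VW) mulmx1.
  by rewrite mulmxBl mulmxBl E addrK.
- have sj1 j : (j <= j.+1)%N by [].
  apply: mxcvg_unique (mxcvg_sub sj1 sD) _.
  have := mxcvg_diagpart (mxcvgB (mxcvg_cst Sigma) (mxcvg_sub sj1 sHH)).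
  suff E j : diagpart (Sigma - H (s j.+1) *m (H (s j.+1))^T) = D (s j.+1).
    by under eq_fun do rewrite /= E.
  by have := sj j.+1; case: (s j.+1) => // t _; rewrite (HD t).2.
Qed.

End algorithm.

Unset Implicit Arguments.
Set Strict Implicit.

Theorem proposition5p4 (R : realType) (n k : nat) (k_gt0 : (0 < k)%N)
    (k_lt_n : (k < n)%N) (Sigma : 'M[R]_n) (Sigma_pd : pdmx Sigma)
    (H : nat -> 'M[R]_(n, k)) (D : nat -> 'M[R]_n)
    (D0_diag : is_diag_mx (D 0%N)) (D0_psd : psdmx (D 0%N))
    (cov0_unit : H 0%N *m (H 0%N)^T + D 0%N \in unitmx)
    (HD : fa_algorithm Sigma H D) :
  (* (a) *)
  (forall t, (1 <= t)%N -> psdmx (Sigma - H t *m (H t)^T)) /\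
  (* (b) *)
  (pdmx (D 0%N) -> pdmx (diagpart (Sigma - D 0%N)) ->
    forall t, (1 <= t)%N -> pdmx (D t)) /\
  (* (c) *)
  (forall t, (1 <= t)%N -> fa_R Sigma (H t) (D t) \in unitmx) /\
  (* (d) *)
  (forall t, H t *m (H t)^T + D t = Sigma -> H t.+1 = H t /\ D t.+1 = D t) /\
  (* (e) *)
  (forall Q : nat -> 'M[R]_k,
    Q 0%N \in unitmx ->
    (forall t, Q t.+1 = sqrtmx (fa_R Sigma (H t) (D t)) *m Q t) ->
    forall t,
      (idiv Sigma (fa_cov (H t) (D t)) - idiv Sigma (fa_cov (H t.+1) (D t.+1))
       = idiv (fa_Sigma1 (H t.+1) (D t.+1) (Q t.+1))
              (fa_Sigma1 (H t) (D t) (Q t))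
         + idiv (fa_Sigma0 Sigma (H t) (D t) (Q t))
                (fa_Sigma0 Sigma (H t.+1) (D t.+1) (Q t.+1)))%E) /\
  (* (f) *)
  ((forall (H' : 'M[R]_(n, k)) (D' : 'M[R]_n),
      cluster ((fun t => (H t, D t)) @ \oo) (H', D') -> pdmx D' ->
      fa_solution Sigma H' D') /\
   (forall (H' : 'M[R]_(n, k)) (D' : 'M[R]_n) (U : 'M[R]_k),
      fa_solution Sigma H' D' -> U *m U^T = 1%:M ->
      fa_solution Sigma (H' *m U) D')) /\
  (* (g) *)
  (forall HH' D' : 'M[R]_n,
    cluster ((fun t => (H t *m (H t)^T, D t)) @ \oo) (HH', D') ->
    [/\ HH' + D' \in unitmx,
        HH' = Sigma *m invmx (HH' + D') *m HH'
      & D' = diagpart (Sigma - HH')]).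
Proof.
have inv := fa_invariant Sigma_pd D0_diag D0_psd cov0_unit HD.
have HS := fa_HS HD; have DS := fa_DS HD.
split; last split; last split; last split; last split; last split; last first.
- exact: fa_limit_gram.
- split; first exact: fa_limit_solution.
  move=> H' D' U [uD HE DE] UU; have UH : H' *m U *m (H' *m U)^T = H' *m H'^T.
    by rewrite trmx_mul mulmxA -[H' *m U *m U^T]mulmxA UU mulmx1.
  by split; rewrite ?UH// mulmxA -HE.
- move=> Q Q0 QS t; apply: fa_idiv_step => //.
  elim: t => // t uQ; have [_ pD pS] := inv t; rewrite QS.
  exact: fa_Q_unit.
- move=> t SE; have [dD pD pS] := inv t; rewrite DS HS.
  exact: fa_cov_fixed.
- by move=> t _; have [_ pD pS] := inv t; exact/pd_unit/fa_R_pd.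
- move=> D0_pd _ t _; elim: t => // t pDt; have [_ pD pS] := inv t; rewrite DS.
  exact/pd_diagpart/(fa_residual_pd Sigma_pd pD pS).
- case=> // t _; have [_ pD pS] := inv t; rewrite HS.
  exact: (fa_residual_psd Sigma_pd pD pS).
Qed.
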